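(* Let $(M,\lambda,J)$ be a contact triad, let $(\dot\Sigma,j)$ be a (possibly punctured) Riemann surface with a K\''ahler metric $h$ of Gaussian curvature $K$, and let $w:\dot\Sigma\to M$ be a contact Cauchy--Riemann map, i.e. a smooth map with $\overline{\partial}^\pi w=0$. Let $e^\pi=|d^\pi w|^2$. Then $$ - \frac{1}{2} \Delta e^\pi = |\nabla^\pi(\partial^\pi w)|^2 + K\, |\partial^\pi w|^2 + \langle \mathrm{Ric}^{\nabla^\pi}(w)\, \partial^\pi w, \partial^\pi w\rangle + \left\langle \delta^{\nabla^\pi} \left((w^*\lambda \circ j) \wedge (\mathcal{L}_{X_\lambda}J)\, \partial^\pi w\right), \partial^\pi w \right\rangle . $$
   Context: Contact triad: $M$ is a smooth $(2n+1)$-dimensional manifold with a co-oriented contact structure $\xi=\ker\lambda$, where $\lambda$ is a contact form. The Reeb vector field $X_\lambda$ is defined by $\lambda(X_\lambda)=1$, $X_\lambda\rfloor d\lambda=0$. $J:\xi\to\xi$ is an endomorphism with $J^2=-\mathrm{id}$, compatible with $d\lambda$ in the sense that $g_\xi=d\lambda(\cdot,J\cdot)$ makes $(\xi,J,g_\xi)$ a Hermitian vector bundle; $J$ is extended to $TM$ by $JX_\lambda=0$. The triple $(M,\lambda,J)$ is called a contact triad and $M$ carries the triad metric $g=g_\xi+\lambda\otimes\lambda$. $\pi:TM\to\xi$ is the projection along $X_\lambda$; $\mathcal{L}$ is the Lie derivative. Contact triad connection: $\nabla$ denotes the unique affine connection on $M$ (its existence and uniqueness are known) with torsion $T(X,Y)=\nabla_XY-\nabla_YX-[X,Y]$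 such that: (1) $\nabla g=0$; (2) $T(X_\lambda,\cdot)=0$; (3) $\nabla_{X_\lambda}X_\lambda=0$ and $\nabla_YX_\lambda\in\xi$ for $Y\in\xi$; (4) $\nabla^\pi:=\pi\nabla|_\xi$ is a Hermitian connection on $(\xi,d\lambda|_\xi,J)$; (5) $T^\pi:=\pi T$ satisfies $T^\pi(JY,Y)=0$ for all $Y\in\xi$; (6) $\nabla_YX_\lambda-J\nabla_{JY}X_\lambda=0$ for $Y\in\xi$. For a smooth map $w:\dot\Sigma\to M$: $d^\pi w:=\pi\, dw$ is a $w^*\xi$-valued $1$-form, $\overline{\partial}^\pi w=\frac12(\pi dw+J\pi dw\circ j)$, $\partial^\pi w=\frac12(\pi dw-J\pi dw\circ j)$. The bundle $T^*\dot\Sigma\otimes w^*\xi$ has the inner product $\langle\alpha\otimes\zeta,\beta\otimes\eta\rangle=h(\alpha,\beta)g_\xi(\zeta,\eta)$ and the connection, also denoted $\nabla^\pi$, induced by the pull-back of $\nabla^\pi$ to $w^*\xi$ and the Levi-Civita connection of $h$. Operators on $w^*\xi$-valued forms: $d^{\nabla^\pi}(\alpha\otimes\zeta)=d\alpha\otimes\zeta+(-1)^k\alpha\wedge\nabla^\pi\zeta$ for a $k$-form $\alpha$; the Hodge star is extended by $*(\alpha\otimes\zeta)=( *\alpha)\otimes\zeta$; $\delta^{\nabla^\pi}=-*d^{\nabla^\pi}*$. On $1$-forms $*\alpha=-\alpha\circ j$. The wedge of a real $1$-form $\alpha$ and a vector-valued $1$-form $\beta$ is $(\alpha\wedge\beta)(v_1,v_2)=\alpha(v_1)\beta(v_2)-\alpha(v_2)\beta(v_1)$.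 $\Delta=d\delta+\delta d$ is the (nonnegative) Hodge Laplacian of $h$ on functions. The Ricci operator along $w$ is $\big(\mathrm{Ric}^{\nabla^\pi}(w)\beta\big)(v)=\sum_i R(e_i,v)\,\beta(e_i)$ for a $w^*\xi$-valued $1$-form $\beta$, where $\{e_i\}$ is a local $h$-orthonormal frame of $T\dot\Sigma$ and $R(X,Y)=\nabla^\pi_X\nabla^\pi_Y-\nabla^\pi_Y\nabla^\pi_X-\nabla^\pi_{[X,Y]}$ is the curvature of the pull-back connection on $w^*\xi$. *)

(* Defs.v *)
From mathcomp Require Import all_boot all_order all_algebra.
From mathcomp Require Import all_classical all_reals topology normedtype derive.

Set Implicit Arguments.
Unset Strict Implicit.
Unset Printing Implicit Defensive.

Import Order.TTheory GRing.Theory Num.Theory.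
Import numFieldNormedType.Exports.

Local Open Scope classical_set_scope.
Local Open Scope ring_scope.

(* Smooth manifolds are given by atlases over an arbitrary [R : realType].
   Tensor fields and connections are given by their
   expressions in the charts, subject to the usual change-of-chart rules; the
   tangent space at a point is identified, in each chart, with the row vectors
   ['rV[R]_m].  Functions written in a chart are total, and only their values
   on the image of the chart are meaningful. *)

(** ** Calculus on open subsets of R^m *)

Section Calculus.
Context {R : realType} {m : nat}.
Local Notation E := 'rV[R]_m.

(* A function is C^oo on the open set [U] iff all its iterated directional
   derivatives are (Frechet) differentiable at every point of [U]. *)
Definition iter_derive {W : normedModType R} (f : E -> W) (s : seq E) : E -> W :=
  foldr (fun v g => 'D_v g) f s.

Definition smooth_on {W : normedModType R} (U : set E) (f : E -> W) : Prop :=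
  forall (s : seq E) (x : E), U x -> differentiable (iter_derive f s) x.

Definition lie_bracket (X Y : E -> E) (x : E) : E :=
  'D_(X x) Y x - 'D_(Y x) X x.

(* (L_X J) V = [X, J V] - J [X, V], evaluated on the vector [v] at [x]; the
   value does not depend on the extension of [v] and the constant one is used. *)
Definition lie_endo (X : E -> E) (J : E -> E -> E) (x v : E) : E :=
  lie_bracket X (fun y => J y v) x - J x (lie_bracket X (cst v) x).

(* (d l)(U, V) = U (l V) - V (l U) - l [U, V] on constant vector fields. *)
Definition ext_d (l : E -> E -> R) (x u v : E) : R :=
  'D_u (fun y => l y v) x - 'D_v (fun y => l y u) x.

(* Covariant derivative, torsion and curvature of D + G, where [G] collects
   the Christoffel symbols: G x u v = sum u_i v_j Gamma_ij^k(x) e_k. *)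
Definition nabla (G : E -> E -> E -> E) (X Y : E -> E) (x : E) : E :=
  'D_(X x) Y x + G x (X x) (Y x).

Definition torsion (G : E -> E -> E -> E) (X Y : E -> E) (x : E) : E :=
  nabla G X Y x - nabla G Y X x - lie_bracket X Y x.

Definition curvature (G : E -> E -> E -> E) (X Y Z : E -> E) (x : E) : E :=
  nabla G X (nabla G Y Z) x - nabla G Y (nabla G X Z) x
  - nabla G (lie_bracket X Y) Z x.

End Calculus.

(** ** Smooth manifolds and fields on them *)

Record manifold (R : realType) (m : nat) := Manifold {
  mcarrier :> topologicalType;
  chart : Type;
  chart_dom : chart -> set mcarrier;
  chart_img : chart -> set 'rV[R]_m;
  chart_map : chart -> mcarrier -> 'rV[R]_m;
  chart_inv : chart -> 'rV[R]_m -> mcarrier;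
  manifold_hausdorff : hausdorff_space mcarrier;
  manifold_countable : @second_countable mcarrier;
  chart_dom_open : forall a, open (chart_dom a);
  chart_img_open : forall a, open (chart_img a);
  chart_dom_cover : forall p, exists a, chart_dom a p;
  chart_map_img : forall a p, chart_dom a p -> chart_img a (chart_map a p);
  chart_inv_dom : forall a x, chart_img a x -> chart_dom a (chart_inv a x);
  chart_mapK : forall a p, chart_dom a p -> chart_inv a (chart_map a p) = p;
  chart_invK : forall a x, chart_img a x -> chart_map a (chart_inv a x) = x;
  chart_map_continuous : forall a p, chart_dom a p -> {for p, continuous (chart_map a)};
  chart_inv_continuous : forall a x, chart_img a x -> {for x, continuous (chart_inv a)};
  transition_smooth : forall a b,
    smooth_on [set x | chart_img a x /\ chart_dom b (chart_inv a x)]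
      (fun x => chart_map b (chart_inv a x))
}.

Arguments chart {R m} M : rename.
Arguments chart_dom {R m M} _ _ : rename.
Arguments chart_img {R m M} _ _ : rename.
Arguments chart_map {R m M} _ _ : rename.
Arguments chart_inv {R m M} _ _ : rename.

Section Fields.
Context {R : realType} {m : nat} (M : manifold R m).
Local Notation E := 'rV[R]_m.

Definition overlap (a b : chart M) : set E :=
  [set x | chart_img a x /\ chart_dom b (chart_inv a x)].

Definition transition (a b : chart M) (x : E) : E := chart_map b (chart_inv a x).

Record vector_field := VectorField {
  vf_val :> chart M -> E -> E;
  vf_smooth : forall a, smooth_on (chart_img a) (vf_val a);
  vf_change : forall a b x, overlap a b x ->
    vf_val b (transition a b x) = 'D_(vf_val a x) (transition a b) x
}.

Record one_form := OneForm {
  of_val :> chart M -> E -> E -> R;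
  of_scalar : forall a x, chart_img a x -> scalar (of_val a x);
  of_smooth : forall a v, smooth_on (chart_img a) (fun x => of_val a x v);
  of_change : forall a b x v, overlap a b x ->
    of_val b (transition a b x) ('D_v (transition a b) x) = of_val a x v
}.

(* Sections of End(TM). *)
Record endo_field := EndoField {
  ef_val :> chart M -> E -> E -> E;
  ef_linear : forall a x, chart_img a x -> linear (ef_val a x);
  ef_smooth : forall a v, smooth_on (chart_img a) (fun x => ef_val a x v);
  ef_change : forall a b x v, overlap a b x ->
    ef_val b (transition a b x) ('D_v (transition a b) x) =
    'D_(ef_val a x v) (transition a b) x
}.

Record riemannian_metric := RiemannianMetric {
  rm_val :> chart M -> E -> E -> E -> R;
  rm_scalar : forall a x u, chart_img a x -> scalar (rm_val a x u);
  rm_sym : forall a x u v, chart_img a x -> rm_val a x u v = rm_val a x v u;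
  rm_pos : forall a x v, chart_img a x -> v != 0 -> 0 < rm_val a x v v;
  rm_smooth : forall a u v, smooth_on (chart_img a) (fun x => rm_val a x u v);
  rm_change : forall a b x u v, overlap a b x ->
    rm_val b (transition a b x)
      ('D_u (transition a b) x) ('D_v (transition a b) x) = rm_val a x u v
}.

(* An affine connection on the tangent bundle, by its Christoffel symbols. *)
Record connection := Connection {
  cn_val :> chart M -> E -> E -> E -> E;
  cn_linearl : forall a x v, chart_img a x -> linear (fun u => cn_val a x u v);
  cn_linearr : forall a x u, chart_img a x -> linear (cn_val a x u);
  cn_smooth : forall a u v, smooth_on (chart_img a) (fun x => cn_val a x u v);
  cn_change : forall a b x u v, overlap a b x ->
    cn_val b (transition a b x)
      ('D_u (transition a b) x) ('D_v (transition a b) x) =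
    'D_(cn_val a x u v) (transition a b) x
    - 'D_u ('D_v (transition a b)) x
}.

Definition levi_civita (h : riemannian_metric) (D : connection) : Prop :=
  forall (a : chart M) (X Y Z : E -> E),
    smooth_on (chart_img a) X -> smooth_on (chart_img a) Y -> smooth_on (chart_img a) Z ->
  forall x, chart_img a x ->
    torsion (D a) X Y x = 0 /\
    'D_(X x) (fun y => h a y (Y y) (Z y)) x =
      h a x (nabla (D a) X Y x) (Z x) + h a x (Y x) (nabla (D a) X Z x).

End Fields.

(** ** Contact triads and the contact triad connection *)

(* The Reeb field is determined by its two defining equations. *)
Record contact_triad (R : realType) (n : nat) (M : manifold R n.*2.+1) :=
 ContactTriad {
  lambda : one_form M;
  reeb : vector_field M;
  ctJ : endo_field M;
  lambda_neq0 : forall a x, chart_img a x -> exists v, lambda a x v != 0;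
  dlambda_nondegenerate : forall a x u, chart_img a x -> lambda a x u = 0 ->
    (forall v, lambda a x v = 0 -> ext_d (lambda a) x u v = 0) -> u = 0;
  lambda_reeb : forall a x, chart_img a x -> lambda a x (reeb a x) = 1;
  dlambda_reeb : forall a x v, chart_img a x ->
    ext_d (lambda a) x (reeb a x) v = 0;
  ctJ_reeb : forall a x, chart_img a x -> ctJ a x (reeb a x) = 0;
  ctJ_xi : forall a x v, chart_img a x -> lambda a x v = 0 ->
    lambda a x (ctJ a x v) = 0;
  ctJ_sqr : forall a x v, chart_img a x -> lambda a x v = 0 ->
    ctJ a x (ctJ a x v) = - v;
  (* g_xi = d lambda (., J .) is a J-invariant inner product on xi *)
  gxi_sym : forall a x u v, chart_img a x -> lambda a x u = 0 -> lambda a x v = 0 ->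
    ext_d (lambda a) x u (ctJ a x v) = ext_d (lambda a) x v (ctJ a x u);
  gxi_pos : forall a x v, chart_img a x -> lambda a x v = 0 -> v != 0 ->
    0 < ext_d (lambda a) x v (ctJ a x v);
  gxi_invariant : forall a x u v, chart_img a x ->
    lambda a x u = 0 -> lambda a x v = 0 ->
    ext_d (lambda a) x (ctJ a x u) (ctJ a x (ctJ a x v)) =
    ext_d (lambda a) x u (ctJ a x v)
}.

Section TriadConnection.
Context {R : realType} {n : nat} {M : manifold R n.*2.+1}.
Variable C : contact_triad M.
Local Notation E := 'rV[R]_(n.*2.+1).

Definition xi_proj (b : chart M) (y v : E) : E :=
  v - lambda C b y v *: reeb C b y.

Definition g_xi (b : chart M) (y u v : E) : R :=
  ext_d (lambda C b) y u (ctJ C b y v).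

Definition triad_metric (b : chart M) (y u v : E) : R :=
  g_xi b y (xi_proj b y u) (xi_proj b y v) + lambda C b y u * lambda C b y v.

Definition xi_section (b : chart M) (Y : E -> E) : Prop :=
  smooth_on (chart_img b) Y /\ forall y, chart_img b y -> lambda C b y (Y y) = 0.

Record triad_connection (nab : connection M) : Prop := TriadConnection {
  tc_metric : forall b X Y Z y,
    smooth_on (chart_img b) X -> smooth_on (chart_img b) Y -> smooth_on (chart_img b) Z ->
    chart_img b y ->
    'D_(X y) (fun z => triad_metric b z (Y z) (Z z)) y =
      triad_metric b y (nabla (nab b) X Y y) (Z y)
      + triad_metric b y (Y y) (nabla (nab b) X Z y);
  tc_torsion_reeb : forall b Y y, smooth_on (chart_img b) Y -> chart_img b y ->
    torsion (nab b) (reeb C b) Y y = 0;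
  tc_reeb_reeb : forall b y, chart_img b y ->
    nabla (nab b) (reeb C b) (reeb C b) y = 0;
  tc_reeb_xi : forall b Y y, xi_section b Y -> chart_img b y ->
    lambda C b y (nabla (nab b) Y (reeb C b) y) = 0;
  (* pi nabla is Hermitian: it preserves J and g_xi on xi *)
  tc_hermitian_J : forall b X Y y,
    smooth_on (chart_img b) X -> xi_section b Y -> chart_img b y ->
    xi_proj b y (nabla (nab b) X (fun z => ctJ C b z (Y z)) y) =
    ctJ C b y (xi_proj b y (nabla (nab b) X Y y));
  tc_hermitian_g : forall b X Y Z y,
    smooth_on (chart_img b) X -> xi_section b Y -> xi_section b Z -> chart_img b y ->
    'D_(X y) (fun z => g_xi b z (Y z) (Z z)) y =
      g_xi b y (xi_proj b y (nabla (nab b) X Y y)) (Z y)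
      + g_xi b y (Y y) (xi_proj b y (nabla (nab b) X Z y));
  tc_torsion_xi : forall b Y y, xi_section b Y -> chart_img b y ->
    xi_proj b y (torsion (nab b) (fun z => ctJ C b z (Y z)) Y y) = 0;
  tc_dbar_reeb : forall b Y y, xi_section b Y -> chart_img b y ->
    nabla (nab b) Y (reeb C b) y
    - ctJ C b y (nabla (nab b) (fun z => ctJ C b z (Y z)) (reeb C b) y) = 0
}.

End TriadConnection.

(** ** Riemann surfaces with a Kaehler metric *)

(* Almost complex structures on surfaces are integrable, so a complex
   structure is just a [j] with j^2 = -1. *)
Record riemann_surface (R : realType) := RiemannSurface {
  rs_manifold :> manifold R 2;
  rs_j : endo_field rs_manifold;
  rs_j_sqr : forall a x v, chart_img a x -> rs_j a x (rs_j a x v) = - v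
}.

(* The Kaehler form h(j ., .) is a 2-form on a surface, hence closed. *)
Record kahler_metric (R : realType) (S : riemann_surface R) := KahlerMetric {
  km_metric :> riemannian_metric S;
  km_invariant : forall a x u v, chart_img a x ->
    km_metric a x (rs_j S a x u) (rs_j S a x v) = km_metric a x u v
}.

Section Surface.
Context {R : realType} {S : riemann_surface R}.
Variables (h : kahler_metric S) (D : connection S) (a : chart S).
Local Notation P := 'rV[R]_2.
Local Notation d_ i := (delta_mx 0 i : 'rV[R]_2).

Definition gram (x : P) : 'M[R]_2 := \matrix_(i, k) h a x (d_ i) (d_ k).

(* h-trace sum_ik h^ik B(d_i, d_k) of a bilinear form B. *)
Definition h_trace (x : P) (B : P -> P -> R) : R :=
  \sum_i \sum_k invmx (gram x) i k * B (d_ i) (d_ k).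

(* Meant for [D] the Levi-Civita connection of [h]. *)
Definition gauss_curvature (x : P) : R :=
  h a x (curvature (D a) (cst (d_ 0)) (cst (d_ 1)) (cst (d_ 1)) x) (d_ 0)
  / \det (gram x).

Definition area_form (x u v : P) : R := h a x (rs_j S a x u) v.

(* The Hodge star on V-valued 1-forms and 2-forms. *)
Definition star1 {V : lmodType R} (al : P -> P -> V) (x v : P) : V :=
  - al x (rs_j S a x v).

Definition star2 {V : lmodType R} (om : P -> P -> P -> V) (x : P) : V :=
  (area_form x (d_ 0) (d_ 1))^-1 *: om x (d_ 0) (d_ 1).

Definition codiff (al : P -> P -> R) (x : P) : R :=
  - star2 (V := R^o) (ext_d (star1 (V := R^o) al)) x.

(* Delta = d delta + delta d; delta vanishes on functions. *)
Definition laplacian (f : P -> R) : P -> R := codiff (fun x v => 'D_v f x).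

Definition wedge {V : lmodType R} (al : P -> P -> R) (be : P -> P -> V)
    (x u v : P) : V :=
  al x u *: be x v - al x v *: be x u.

Definition orthonormal_frame (x : P) (e : 'I_2 -> P) : Prop :=
  forall i k, h a x (e i) (e k) = (i == k)%:R.

End Surface.

(** ** Maps from a surface into a contact triad *)

Section Along.
Context {R : realType} {n : nat} {M : manifold R n.*2.+1}.
Variable C : contact_triad M.
Variable nab : connection M.
Context {S : riemann_surface R}.
Variables (h : kahler_metric S) (D : connection S) (w : S -> M).
Local Notation P := 'rV[R]_2.
Local Notation E := 'rV[R]_(n.*2.+1).

Definition rep_dom (a : chart S) (b : chart M) : set P :=
  [set x | chart_img a x /\ chart_dom b (w (chart_inv a x))].

Definition rep (a : chart S) (b : chart M) (x : P) : E := chart_map b (w (chart_inv a x)).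

Definition smooth_map : Prop :=
  continuous w /\ forall a b, smooth_on (rep_dom a b) (rep a b).

(* Everything below is written in a chart [a] of S and a chart [b] of M: a
   section of w^*TM is a function [P -> E], and a w^*TM-valued 1-form a
   function [P -> P -> E] linear in its second argument. *)
Variables (a : chart S) (b : chart M).

Definition d_pi (x v : P) : E := xi_proj C b (rep a b x) ('D_v (rep a b) x).

Definition dbar_pi (x v : P) : E :=
  2^-1 *: (d_pi x v + ctJ C b (rep a b x) (d_pi x (rs_j S a x v))).

Definition del_pi (x v : P) : E :=
  2^-1 *: (d_pi x v - ctJ C b (rep a b x) (d_pi x (rs_j S a x v))).

(* The pull-back of pi nabla to w^*xi. *)
Definition nabla_pi (X : P -> P) (s : P -> E) (x : P) : E :=
  xi_proj C b (rep a b x)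
    ('D_(X x) s x + nab b (rep a b x) ('D_(X x) (rep a b) x) (s x)).

Definition curvature_pi (X Y : P -> P) (s : P -> E) (x : P) : E :=
  nabla_pi X (nabla_pi Y s) x - nabla_pi Y (nabla_pi X s) x
  - nabla_pi (lie_bracket X Y) s x.

(* (nabla_u be)(v), for the connection induced by nabla_pi and D. *)
Definition nabla_form (be : P -> P -> E) (x u v : P) : E :=
  nabla_pi (cst u) (be^~ v) x - be x (nabla (D a) (cst u) (cst v) x).

Definition form_inner (x : P) (be ga : P -> E) : R :=
  h_trace h a x (fun u v => g_xi C b (rep a b x) (be u) (ga v)).

Definition form_norm2 (x : P) (be : P -> E) : R := form_inner x be be.

(* Squared norm on T^*S (x) T^*S (x) w^*xi. *)
Definition form2_norm2 (x : P) (be : P -> P -> E) : R :=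
  h_trace h a x (fun u u' => form_inner x (be u) (be u')).

(* R(e_i, v) is tensorial, so the vectors [e i], [v] and [be x (e i)] are
   extended with constant coefficients. *)
Definition ricci_pi (e : 'I_2 -> P) (be : P -> P -> E) (x v : P) : E :=
  \sum_i curvature_pi (cst (e i)) (cst v) (be^~ (e i)) x.

Definition d_nabla0 (s : P -> E) (x v : P) : E := nabla_pi (cst v) s x.

(* delta^nabla = - * d^nabla * on 2-forms. *)
Definition delta_nabla2 (om : P -> P -> P -> E) (x v : P) : E :=
  - star1 a (d_nabla0 (star2 h a om)) x v.

Definition pull_lambda_j (x v : P) : R :=
  lambda C b (rep a b x) ('D_(rs_j S a x v) (rep a b) x).

Definition LJ_del_pi (x v : P) : E :=
  lie_endo (reeb C b) (ctJ C b) (rep a b x) (del_pi x v).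

Definition energy_pi (x : P) : R := form_norm2 x (d_pi x).

End Along.

Definition contact_CR_map (R : realType) (n : nat) (M : manifold R n.*2.+1)
    (C : contact_triad M) (S : riemann_surface R) (w : S -> M) : Prop :=
  smooth_map w /\
  forall (a : chart S) (b : chart M) x v, rep_dom w a b x ->
    dbar_pi C w a b x v = 0.

(* Main.v *)
From HB Require Import structures.
Require Import Defs.
From mathcomp Require Import all_boot all_order all_algebra ring lra.
From mathcomp Require Import all_classical all_reals topology normedtype landau derive.

(* Write beta = d^pi w; on contact Cauchy-Riemann maps it coincides with
   del^pi w, and beta (j v) = J (beta v). Since g(beta u, beta v) is symmetric
   and j-invariant it equals (e^pi / 2) h(u, v), and differentiating this
   identity twice gives
     - Delta e^pi / 2 = |nabla beta|^2 + <tr nabla^2 beta, beta>.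
   The exterior covariant derivative of beta is a 2-form area * s, with s a
   section of w^*xi.  Exchanging the arguments of nabla^2 beta costs a term in
   nabla s, exchanging the derivatives costs curvature, and the remaining trace
   is again a derivative of s by complex linearity.  Together this yields
     <tr nabla^2 beta, beta> = K |beta|^2 + <Ric beta, beta>
                               - 2 sum_k <nabla_(j e_k) s, beta e_k>.
   Finally, the axioms of the triad connection give nabla_Y X_lambda =
   - (1/2) J (L_(X_lambda) J) Y on xi and kill the torsion of w on pairs
   (u, j u), so that area * s is - (1/2) (w^*lambda o j) /\ (L_(X_lambda) J) beta
   and the last term is the codifferential of the statement. *)

Set Implicit Arguments.
Unset Strict Implicit.
Unset Printing Implicit Defensive.

Import Order.TTheory GRing.Theory Num.Theory.
Import numFieldNormedType.Exports.

Local Open Scope classical_set_scope.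
Local Open Scope ring_scope.


(** * Differentiation rules *)

Section Differentiability.
Context {R : realType}.
Implicit Types V W : normedModType R.

Lemma near_eq_differentiable V W (f g : V -> W) x :
  {near x, f =1 g} -> differentiable f x -> differentiable g x.
Proof.
move=> fg df.
have fgx : f x = g x by apply: (nbhs_singleton fg).
have key : g \o shift x = cst (g x) + 'd f x +o_ 0 id.
  apply/eqaddoP => eps eps0.
  have := diff_locally df => /eqaddoP /(_ eps eps0) H.
  have H2 : \forall y \near (0:V), f (y + x) = g (y + x).
    by have := fg; rewrite (near_shift 0)/= subr0.
  apply: filterS2 H2 H => y fgy.
  by rewrite /GRing.add/GRing.opp/= /cst/= -fgx -fgy.
apply/diff_locallyP; split.
  by rewrite (diff_unique (diff_continuous df) key); exact: diff_continuous.
by rewrite (diff_unique (diff_continuous df) key).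
Qed.

Lemma derive_linear V W (f : V -> W) x (k : R) u v : differentiable f x ->
  'D_(k *: u + v) f x = k *: 'D_u f x + 'D_v f x.
Proof. by move=> df; rewrite !deriveE// linearP. Qed.

Lemma derive_comp (U V W : normedModType R) (c : U -> V) (f : V -> W) x v :
  differentiable c x -> differentiable f (c x) ->
  'D_v (fun y => f (c y)) x = 'D_('D_v c x) f (c x).
Proof.
move=> dc df; have := differentiable_comp dc df => dfc.
by rewrite -[fun y => _]/(f \o c) !deriveE// diff_comp.
Qed.

Lemma scale_is_bilinear W :
  bilinear_for
    (GRing.Scale.Law.clone _ _ *:%R _) (GRing.Scale.Law.clone _ _ *:%R _)
    (fun (k : R^o) (w : W) => k *: w).
Proof.
split=> [u'|u] a x y /=.
- by rewrite scalerDl scalerA.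
- by rewrite scalerDr !scalerA mulrC.
Qed.

Lemma differentiable_scale V W (k : V -> R) (f : V -> W) x :
  differentiable k x -> differentiable f x ->
  differentiable (fun y => k y *: f y) x /\
  forall v, 'D_v (fun y => k y *: f y) x = k x *: 'D_v f x + 'D_v k x *: f x.
Proof.
move=> dk df.
pose B : {bilinear R^o -> W -> W} := HB.pack (fun (k : R^o) (w : W) => k *: w)
  (bilinear_isBilinear.Build R R^o W W _ _ _ (@scale_is_bilinear W)).
have cB : continuous (fun p : R^o * W => B p.1 p.2).
  by move=> z; exact: (@scale_continuous R W).
have dB : differentiable (fun p : R^o * W => B p.1 p.2) (k x, f x).
  exact: differentiable_bilin.
have dkf : differentiable (fun y => (k y, f y) : R^o * W) x.
  exact: differentiable_pair.
have E : (fun y => k y *: f y) =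
   (fun p : R^o * W => B p.1 p.2) \o (fun y => (k y, f y) : R^o * W) by [].
split; first by rewrite E; exact: differentiable_comp.
move=> v; rewrite [LHS]deriveE; last by rewrite E; exact: differentiable_comp.
rewrite E diff_comp// (@diff_bilin _ _ _ _ B (k x, f x) cB) /=.
by rewrite diff_pair //= !deriveE.
Qed.

End Differentiability.

Section LinearMaps.
Context {R : realType}.

Definition is_lin (V W : lmodType R) (f : V -> W) : Prop :=
  forall (k : R) u v, f (k *: u + v) = k *: f u + f v.

Section Rules.
Context {V W : lmodType R} {f : V -> W} (lf : is_lin f).

Lemma is_linD u v : f (u + v) = f u + f v.
Proof. by have := lf 1 u v; rewrite !scale1r. Qed.

Lemma is_lin0 : f 0 = 0.
Proof. by apply: (@addIr _ (f 0)); rewrite -is_linD !add0r. Qed.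

Lemma is_linZ k u : f (k *: u) = k *: f u.
Proof. by have := lf k u 0; rewrite !addr0 is_lin0 addr0. Qed.

Lemma is_linN u : f (- u) = - f u.
Proof. by rewrite -scaleN1r is_linZ scaleN1r. Qed.

Lemma is_linB u v : f (u - v) = f u - f v.
Proof. by rewrite is_linD is_linN. Qed.

Lemma is_lin_sum (I : Type) (r : seq I) (P : pred I) (s : I -> V) :
  f (\sum_(i <- r | P i) s i) = \sum_(i <- r | P i) f (s i).
Proof. by apply: (big_morph f is_linD is_lin0). Qed.

End Rules.

Lemma is_lin_coord (W : lmodType R) m (f : 'rV[R]_m -> W) : is_lin f ->
  forall v, f v = \sum_i v 0 i *: f (delta_mx 0 i).
Proof.
move=> lf v; rewrite {1}(row_sum_delta v) is_lin_sum//.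
by apply: eq_bigr => i _; rewrite is_linZ.
Qed.

Lemma scaleDD (V : lmodType R) (k : R) (x y z t : V) :
  k *: x + y + (k *: z + t) = k *: (x + z) + (y + t).
Proof. by rewrite scalerDr addrACA. Qed.

Lemma scaleDB (V : lmodType R) (k : R) (x y z t : V) :
  k *: x + y - (k *: z + t) = k *: (x - z) + (y - t).
Proof. by rewrite scalerBr opprD addrACA. Qed.

Definition is_bilin (V V' W : lmodType R) (B : V -> V' -> W) : Prop :=
  (forall u, is_lin (B u)) /\ (forall v, is_lin (B^~ v)).

End LinearMaps.

Section Ck.
Context {R : realType}.
Implicit Types V W : normedModType R.

Lemma near_open V (U : set V) (P : V -> Prop) x :
  open U -> U x -> (forall y, U y -> P y) -> \forall y \near x, P y.
Proof.
move=> oU Ux H; have : nbhs x U by exact: open_nbhs_nbhs.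
exact: filterS.
Qed.

Lemma eq_on_derive V W (U : set V) (f g : V -> W) x v :
  open U -> U x -> (forall y, U y -> f y = g y) -> 'D_v f x = 'D_v g x.
Proof. by move=> oU Ux fg; apply: near_eq_derive; exact: (near_open oU). Qed.

Lemma eq_on_differentiable V W (U : set V) (f g : V -> W) x :
  open U -> U x -> (forall y, U y -> f y = g y) ->
  differentiable f x -> differentiable g x.
Proof. by move=> oU Ux fg; apply: near_eq_differentiable; exact: (near_open oU). Qed.

Lemma is_lin_derive V W (f : V -> W) x : differentiable f x ->
  is_lin (fun v => 'D_v f x).
Proof. by move=> df k u v; exact: derive_linear. Qed.

(* [smooth_on] cut at order [n] and made recursive on the outermost derivative,
   so that closure properties go by induction on [n]. *)
Fixpoint Ck V W (n : nat) (U : set V) (f : V -> W) : Prop :=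
  (forall x, U x -> differentiable f x) /\
  if n is n'.+1 then forall v, Ck n' U ('D_v f) else True.

Lemma Ck_diff V W n (U : set V) (f : V -> W) x : Ck n U f -> U x -> differentiable f x.
Proof. by case: n => [|n] [H _]; exact: H. Qed.

Lemma Ck_derive V W n (U : set V) (f : V -> W) v : Ck n.+1 U f -> Ck n U ('D_v f).
Proof. by move=> [_ H]; exact: H. Qed.

Lemma CkS V W n (U : set V) (f : V -> W) : Ck n.+1 U f -> Ck n U f.
Proof.
elim: n f => [|n IH] f [df H]; split=> // v.
by apply: IH; exact: H.
Qed.

Lemma Ck_sub V W n (U U' : set V) (f : V -> W) :
  (forall x, U x -> U' x) -> Ck n U' f -> Ck n U f.
Proof.
move=> UU'; elim: n f => [|n IH] f [df H]; split=> //.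
- by move=> x /UU'; exact: df.
- by move=> x /UU'; exact: df.
- by move=> v; exact: (IH _ (H v)).
Qed.

Lemma Ck_eq V W n (U : set V) (f g : V -> W) : open U ->
  (forall y, U y -> f y = g y) -> Ck n U f -> Ck n U g.
Proof.
move=> oU; elim: n f g => [|n IH] f g fg [df H]; split=> //.
- by move=> x Ux; apply: (eq_on_differentiable oU Ux fg); exact: df.
- by move=> x Ux; apply: (eq_on_differentiable oU Ux fg); exact: df.
- move=> v; apply: IH (H v) => y Uy; exact: (eq_on_derive v oU Uy fg).
Qed.

Lemma smooth_on_Ck m W n (U : set 'rV[R]_m) (f : 'rV[R]_m -> W) :
  smooth_on U f -> Ck n U f.
Proof.
elim: n f => [|n IH] f sf; split=> //.
- by move=> x Ux; exact: (sf [::]).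
- by move=> x Ux; exact: (sf [::]).
- move=> v; apply: IH => s x Ux.
  by have := sf (rcons s v) x Ux; rewrite /iter_derive foldr_rcons.
Qed.

Lemma Ck_smooth_on m W (U : set 'rV[R]_m) (f : 'rV[R]_m -> W) :
  (forall n, Ck n U f) -> smooth_on U f.
Proof.
move=> Cf s; move: (Cf (size s)) => {Cf}.
elim/last_ind: s f => [|s v IH] f Cf x Ux; first exact: (Ck_diff Cf Ux).
rewrite /iter_derive foldr_rcons; apply: IH => //.
by move: Cf; rewrite size_rcons; exact: Ck_derive.
Qed.

Lemma Ck_cst V W n (U : set V) (c : W) : Ck n U (cst c).
Proof.
elim: n c => [|n IH] c; split => //;
  try by move=> x _; exact: differentiable_cst.
move=> v; rewrite (_ : 'D_v (cst c) = cst 0); first exact: IH.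
by apply/funext => x; rewrite derive_cst.
Qed.

Lemma CkD V W n (U : set V) (f g : V -> W) : open U ->
  Ck n U f -> Ck n U g -> Ck n U (fun y => f y + g y).
Proof.
move=> oU; elim: n f g => [|n IH] f g [df Hf] [dg Hg]; split=> //.
- by move=> x Ux; apply: differentiableD; [exact: df|exact: dg].
- by move=> x Ux; apply: differentiableD; [exact: df|exact: dg].
- move=> v; apply: Ck_eq (IH _ _ (Hf v) (Hg v)) => // y Uy.
  by symmetry; apply: (@deriveD _ _ _ f g); apply: diff_derivable; [exact: df|exact: dg].
Qed.

Lemma Ck_scale V W n (U : set V) (k : V -> R) (f : V -> W) : open U ->
  Ck n U k -> Ck n U f -> Ck n U (fun y => k y *: f y).
Proof.
move=> oU; elim: n k f => [|n IH] k f Ck Cf.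
  split=> // x Ux.
  by have [] := differentiable_scale (Ck_diff Ck Ux) (Ck_diff Cf Ux).
split=> [x Ux|v].
  by have [] := differentiable_scale (Ck_diff Ck Ux) (Ck_diff Cf Ux).
have [H1 H2] := (IH _ _ (CkS Ck) (Ck_derive v Cf), IH _ _ (Ck_derive v Ck) (CkS Cf)).
apply: Ck_eq (CkD oU H1 H2) => // y Uy.
by have [_ ->] := differentiable_scale (Ck_diff Ck Uy) (Ck_diff Cf Uy).
Qed.

Lemma CkN V W n (U : set V) (f : V -> W) : open U ->
  Ck n U f -> Ck n U (fun y => - f y).
Proof.
move=> oU Cf; apply: Ck_eq (Ck_scale oU (Ck_cst n U (-1 : R)) Cf) => // y Uy.
by rewrite scaleN1r.
Qed.

Lemma CkB V W n (U : set V) (f g : V -> W) : open U ->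
  Ck n U f -> Ck n U g -> Ck n U (fun y => f y - g y).
Proof. by move=> oU Cf Cg; exact: CkD oU Cf (CkN oU Cg). Qed.

Lemma Ck_sum V W n (U : set V) (I : Type) (r : seq I) (f : I -> V -> W) : open U ->
  (forall i, Ck n U (f i)) -> Ck n U (fun y => \sum_(i <- r) f i y).
Proof.
move=> oU H; elim: r => [|i r IH].
  by apply: Ck_eq (Ck_cst n U 0) => // y _; rewrite big_nil.
by apply: Ck_eq (CkD oU (H i) IH) => // y _; rewrite big_cons.
Qed.

Lemma derive_coord V m (c : V -> 'rV[R]_m) i x v : differentiable c x ->
  'D_v (fun y => c y 0 i) x = 'D_v c x 0 i.
Proof. by move=> dc; rewrite [in RHS]derive_mx ?mxE//; exact: diff_derivable. Qed.

Lemma differentiable_coordE V m (c : V -> 'rV[R]_m) i x : differentiable c x ->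
  differentiable (fun y => c y 0 i) x.
Proof.
move=> dc; rewrite -[fun y => _]/((fun M : 'rV[R]_m => M 0 i) \o c).
by apply: differentiable_comp => //; exact: differentiable_coord.
Qed.

Lemma Ck_coord V m n (U : set V) (c : V -> 'rV[R]_m) i : open U ->
  Ck n U c -> Ck n U (fun y => c y 0 i).
Proof.
move=> oU; elim: n c => [|n IH] c Cc.
  by split=> // x Ux; apply: differentiable_coordE; exact: Ck_diff Cc Ux.
split=> [x Ux|v]; first by apply: differentiable_coordE; exact: Ck_diff Cc Ux.
apply: Ck_eq (IH _ (Ck_derive v Cc)) => // y Uy.
by rewrite derive_coord//; exact: Ck_diff Cc Uy.
Qed.

Lemma Ck_lin V W m n (U : set V) (F : V -> 'rV[R]_m -> W) (s : V -> 'rV[R]_m) :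
  open U -> (forall y, U y -> is_lin (F y)) -> (forall v, Ck n U (F^~ v)) ->
  Ck n U s -> Ck n U (fun y => F y (s y)).
Proof.
move=> oU lF CF Cs.
have H i : Ck n U (fun y => s y 0 i *: F y (delta_mx 0 i)).
  by apply: Ck_scale => //; exact: Ck_coord.
apply: Ck_eq (Ck_sum (index_enum _) oU H) => // y Uy.
by rewrite [RHS]is_lin_coord//; exact: lF.
Qed.

Lemma Ck_comp V W m n (U : set V) (U' : set 'rV[R]_m) (c : V -> 'rV[R]_m)
    (f : 'rV[R]_m -> W) : open U -> (forall y, U y -> U' (c y)) ->
  Ck n U c -> Ck n U' f -> Ck n U (fun y => f (c y)).
Proof.
move=> oU UU'; elim: n f => [|n IH] f Cc Cf.
  by split=> // x Ux; exact: (differentiable_comp (Ck_diff Cc Ux) (Ck_diff Cf (UU' _ Ux))).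
split=> [x Ux|v].
  exact: (differentiable_comp (Ck_diff Cc Ux) (Ck_diff Cf (UU' _ Ux))).
apply: (@Ck_eq _ _ _ _ (fun y => 'D_('D_v c y) f (c y))) => // [y Uy|].
  by rewrite (derive_comp v (Ck_diff Cc Uy) (Ck_diff Cf (UU' _ Uy))).
apply: (@Ck_lin _ _ _ _ _ (fun y w => 'D_w f (c y))) => //.
- by move=> y Uy; apply: is_lin_derive; exact: (Ck_diff Cf (UU' _ Uy)).
- by move=> w; exact: (IH _ (CkS Cc) (Ck_derive w Cf)).
- exact: (Ck_derive v Cc).
Qed.

Lemma Ck_inv V n (U : set V) (f : V -> R) : open U -> (forall y, U y -> f y != 0) ->
  Ck n U f -> Ck n U (fun y => (f y)^-1).
Proof.
move=> oU f0; elim: n => [|n IH] Cf.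
  by split=> // x Ux; apply: differentiableV; [exact: (Ck_diff Cf Ux)|exact: f0].
split=> [x Ux|v].
  by apply: differentiableV; [exact: (Ck_diff Cf Ux)|exact: f0].
have Ci := IH (CkS Cf).
have H : Ck n U (fun y => (- ((f y)^-1 *: (f y)^-1)) *: 'D_v f y).
  by apply: Ck_scale; [|apply: CkN => //; exact: Ck_scale|exact: Ck_derive].
apply: Ck_eq H => // y Uy; rewrite deriveV; first by rewrite expr2 invfM.
- exact: f0.
- by apply: diff_derivable; exact: Ck_diff Cf Uy.
Qed.

Lemma is_lin_derive_param V V' W (U : set V) (F : V -> V' -> W) x u :
  open U -> U x -> (forall y, U y -> is_lin (F y)) ->
  (forall v, differentiable (F^~ v) x) -> is_lin (fun v => 'D_u (F^~ v) x).
Proof.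
move=> oU Ux lF dF k v w.
rewrite (eq_on_derive u oU Ux (g := fun y => k *: F y v + F y w)); last first.
  by move=> y Uy; exact: lF.
rewrite (@deriveD _ _ _ (fun y => k *: F y v) (F^~ w)).
- by rewrite deriveZ//; exact: diff_derivable.
- by apply: derivableZ; exact: diff_derivable.
- exact: diff_derivable.
Qed.

Lemma differentiable_lin V W m (F : V -> 'rV[R]_m -> W) (s : V -> 'rV[R]_m) x :
  (\forall y \near x, is_lin (F y)) ->
  (forall v, differentiable (F^~ v) x) -> differentiable s x ->
  differentiable (fun y => F y (s y)) x /\
  forall u, 'D_u (fun y => F y (s y)) x = 'D_u (F^~ (s x)) x + F x ('D_u s x).
Proof.
move=> lF dF ds.
have lFx : is_lin (F x) by exact: nbhs_singleton lF.
have H i : differentiable (fun y => s y 0 i *: F y (delta_mx 0 i)) x /\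
  forall v, 'D_v (fun y => s y 0 i *: F y (delta_mx 0 i)) x =
   s x 0 i *: 'D_v (F^~ (delta_mx 0 i)) x + 'D_v (fun y => s y 0 i) x *: F x (delta_mx 0 i).
  by apply: differentiable_scale => //; exact: differentiable_coordE.
have K (w : 'rV[R]_m) i : differentiable (fun y => w 0 i *: F y (delta_mx 0 i)) x /\
  forall v, 'D_v (fun y => w 0 i *: F y (delta_mx 0 i)) x =
   w 0 i *: 'D_v (F^~ (delta_mx 0 i)) x.
  have [//|h1 h2] := @differentiable_scale _ _ _ (cst (w 0 i)) _ _ _ (dF (delta_mx 0 i)).
  by split=> // v; rewrite h2 derive_cst scale0r addr0.
have E : \forall y \near x, (\sum_i (fun y => s y 0 i *: F y (delta_mx 0 i))) y = F y (s y).
  apply: filterS lF => y lFy; rewrite fct_sumE.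
  by rewrite [RHS]is_lin_coord.
have E2 (w : 'rV[R]_m) : \forall y \near x, (\sum_i (fun y => w 0 i *: F y (delta_mx 0 i))) y = F y w.
  apply: filterS lF => y lFy; rewrite fct_sumE.
  by rewrite [RHS]is_lin_coord.
split.
  apply: near_eq_differentiable E _.
  by apply: differentiable_sum => i; have [] := H i.
move=> u.
rewrite -(near_eq_derive u E) -(near_eq_derive u (E2 (s x))).
rewrite !derive_sum; try by move=> i; apply: diff_derivable; [have [] := H i|have [] := K (s x) i].
- rewrite [F x _]is_lin_coord// -big_split/=; apply: eq_bigr => i _.
  have [_ ->] := H i; have [_ ->] := K (s x) i; congr (_ + _ *: _).
  exact: derive_coord.
- by move=> i; apply: diff_derivable; have [] := K (s x) i.
- by move=> i; apply: diff_derivable; have [] := H i.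
Qed.

End Ck.

(** * Symmetry of second derivatives *)

Section Schwarz.
Context {R : realType}.

Lemma is_derive_line (V W : normedModType R) (f : V -> W) (u y : V) (s : R) :
  differentiable f (s *: u + y) ->
  is_derive s (1 : R) (fun s => f (s *: u + y)) ('D_u f (s *: u + y)).
Proof.
move=> df.
have [dl El] : differentiable (fun s : R => s *: u + y) s /\ 'D_1 (fun s : R => s *: u + y) s = u.
  have [|d1 E1] := @differentiable_scale R R^o V id (cst u) s _ (differentiable_cst _ _).
    by [].
  split; first by apply: differentiableD => //; exact: differentiable_cst.
  rewrite (@deriveD _ _ _ (fun s : R => s *: u) (cst y)) ?derive_cst ?addr0.
  - by rewrite E1 derive_cst scaler0 add0r derive_id scale1r.
  - exact: diff_derivable.
  - exact: derivable_cst.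
apply: DeriveDef; first by apply: diff_derivable; exact: (differentiable_comp dl df).
by rewrite (derive_comp (1 : R^o) dl df) El.
Qed.

(* The mean value theorem along [u] turns the second difference into [t] times
   an increment of ['D_u f], which is expanded to first order at [x]. *)
Lemma mixed_increment (V : normedModType R) (U : set V) (f : V -> R) x u v (eps : R) :
  open U -> U x -> (forall y, U y -> differentiable f y) ->
  differentiable ('D_u f) x -> 0 < eps ->
  \forall t \near (0 : R), 0 < t ->
    `|f (t *: u + (t *: v + x)) - f (t *: u + x) - (f (t *: v + x) - f x)
      - t ^+ 2 * 'D_v ('D_u f) x| <= eps * t ^+ 2.
Proof.
move=> oU Ux dfU da eps0.
have [r r0 rU] : exists2 r : R, 0 < r & forall h, `|h| < r -> U (h + x).
  have : nbhs x U by exact: open_nbhs_nbhs.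
  move=> /nbhs_ballP[r /= r0 H]; exists r => // h hr.
  by apply: H; rewrite -ball_normE /= opprD addrCA subrr addr0 normrN.
pose C := `|u| + `|v| + 1.
have C0 : 0 < C by rewrite /C; have := normr_ge0 u; have := normr_ge0 v; lra.
have e1 : 0 < eps / (2 * C) by rewrite divr_gt0// mulr_gt0.
have [d d0 dH] : exists2 d : R, 0 < d & forall h, `|h| < d ->
   `|'D_u f (h + x) - ('D_u f x + 'D_h ('D_u f) x)| <= eps / (2 * C) * `|h|.
  have := diff_locally da => /eqaddoP /(_ _ e1) /nbhs_ballP[d /= d0 H].
  exists d => // h hd; rewrite (deriveE h da); apply: H.
  by rewrite -ball_normE /= sub0r normrN.
have m0 : 0 < Num.min r d / C by rewrite divr_gt0// lt_min r0.
apply/nbhs_ballP; exists (Num.min r d / C) => // t /=.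
rewrite -ball_normE /= sub0r normrN => tm t0.
have {tm} tC : t * C < Num.min r d by rewrite -ltr_pdivlMr//; rewrite gtr0_norm in tm.
have bnd (s s' : R) : 0 <= s <= t -> 0 <= s' <= t -> `|s *: u + s' *: v| <= t * C.
  move=> /andP[s0 st] /andP[s0' st'].
  rewrite (le_trans (ler_normD _ _))// !normrZ !ger0_norm// /C !mulrDr.
  have := ler_wpM2r (normr_ge0 u) st; have := ler_wpM2r (normr_ge0 v) st'.
  lra.
have bnd1 (s : R) : 0 <= s <= t -> `|s *: u| <= t * C.
  by move=> st; have := bnd s 0 st; rewrite scale0r addr0; apply; rewrite lexx ltW.
have inU h : `|h| <= t * C -> U (h + x).
  by move=> hC; apply: rU; rewrite (le_lt_trans hC)// (lt_le_trans tC)// ge_min lexx.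
have inU1 s : 0 <= s <= t -> U (s *: u + x) by move=> /bnd1/inU.
have inU2 s : 0 <= s <= t -> U (s *: u + (t *: v + x)).
  by move=> st; rewrite addrA; apply/inU/bnd; rewrite // lexx ltW.
pose phi := (fun s : R => f (s *: u + (t *: v + x))) - (fun s : R => f (s *: u + x)).
have dphi s : 0 <= s <= t ->
   is_derive s 1 phi ('D_u f (s *: u + (t *: v + x)) - 'D_u f (s *: u + x)).
  move=> st; apply: is_deriveB; apply: is_derive_line; apply: dfU.
  - exact: inU2.
  - exact: inU1.
have [||s st E] := @MVT R phi
   (fun s => 'D_u f (s *: u + (t *: v + x)) - 'D_u f (s *: u + x)) 0 t t0.
- by move=> s; rewrite in_itv /= => /andP[s0 s1]; apply: dphi; rewrite !ltW.
- apply: derivable_within_continuous => s; rewrite in_itv /= => st.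
  by have [] := dphi s st.
have {}st : 0 <= s <= t by move: st; rewrite in_itv /= => /andP[s0 s1]; rewrite !ltW.
have tt : 0 <= t <= t by rewrite lexx ltW.
have phiE s' : phi s' = f (s' *: u + (t *: v + x)) - f (s' *: u + x) by [].
move: E; rewrite !phiE !scale0r !add0r subr0 => E.
rewrite E.
have H1 := dH (s *: u + t *: v); have H2 := dH (s *: u).
have b1 := bnd s t st tt; have b2 := bnd1 s st.
have md : t * C < d by rewrite (lt_le_trans tC)// ge_min lexx orbT.
move: (H1 (le_lt_trans b1 md)) (H2 (le_lt_trans b2 md)).
have lda := is_lin_derive da.
rewrite (is_linD lda) !(is_linZ lda) -addrA.
move=> {}H1 {}H2.
have k1 : eps / (2 * C) * `|s *: u + t *: v| <= eps / 2 * t.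
  rewrite (_ : eps / 2 * t = eps / (2 * C) * (t * C)); last first.
    by field; rewrite gt_eqF.
  by apply: ler_wpM2l => //; exact: ltW.
have k2 : eps / (2 * C) * `|s *: u| <= eps / 2 * t.
  rewrite (_ : eps / 2 * t = eps / (2 * C) * (t * C)); last first.
    by field; rewrite gt_eqF.
  by apply: ler_wpM2l => //; exact: ltW.
move: (le_trans H1 k1) (le_trans H2 k2).
set p := 'D_u f _; set q := 'D_u f (s *: u + x); set z := 'D_u f x; set w := s *: 'D_u _ _.
set y := 'D_v _ _; rewrite -[t *: y]/(t * y) => L1 L2.
have -> : (p - q) * t - t ^+ 2 * y = (p - (z + (w + t * y)) - (q - (z + w))) * t.
  by ring.
rewrite normrM (gtr0_norm t0) expr2 (mulrA eps).
apply: ler_wpM2r; first exact: ltW.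
apply: le_trans (ler_normB _ _) _.
rewrite (_ : eps * t = eps / 2 * t + eps / 2 * t); last by field.
exact: lerD.
Qed.

Lemma second_difference_dist (A B D Z a b s eps : R) : 0 < s ->
  `|A - B - (D - Z) - s * a| <= eps / 2 * s ->
  `|A - D - (B - Z) - s * b| <= eps / 2 * s -> `|b - a| <= eps.
Proof.
move=> s0 L1 L2; rewrite -(ler_pM2r s0) -{1}(gtr0_norm s0) -normrM.
rewrite (_ : (b - a) * s =
  (A - B - (D - Z) - s * a) - (A - D - (B - Z) - s * b)); last by ring.
apply: le_trans (ler_normB _ _) _.
rewrite (_ : eps * s = eps / 2 * s + eps / 2 * s); last by field.
exact: lerD.
Qed.

Lemma derive_commute (V : normedModType R) (U : set V) (f : V -> R) x u v :
  open U -> U x -> (forall y, U y -> differentiable f y) ->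
  differentiable ('D_u f) x -> differentiable ('D_v f) x ->
  'D_u ('D_v f) x = 'D_v ('D_u f) x.
Proof.
move=> oU Ux dfU du dv; apply/eqP; rewrite -subr_eq0 -normr_le0.
apply/ler_addgt0Pr => eps eps0; rewrite add0r.
have e2 : 0 < eps / 2 by rewrite divr_gt0.
have H1 := mixed_increment v oU Ux dfU du e2.
have H2 := mixed_increment u oU Ux dfU dv e2.
have /nbhs_ballP[r1 /= r10 rH1] := H1; have /nbhs_ballP[r2 /= r20 rH2] := H2.
pose r := Num.min r1 r2; have r0 : 0 < r by rewrite lt_min r10.
have [t t0 tr] : exists2 t : R, 0 < t & t < r.
  by exists (r / 2); rewrite ?divr_gt0// ltr_pdivrMr// mulr2n mulrDr mulr1 ltrDl.
move: tr; rewrite /r lt_min => /andP[tr1 tr2].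
have b1 : ball (0 : R) r1 t by rewrite -ball_normE /= sub0r normrN gtr0_norm.
have b2 : ball (0 : R) r2 t by rewrite -ball_normE /= sub0r normrN gtr0_norm.
move: (rH1 t b1 t0) (rH2 t b2 t0) => L1 L2.
move: L1 L2; rewrite (addrCA (t *: v) (t *: u) x) => L1 L2.
by apply: (second_difference_dist _ L1 L2); rewrite exprn_gt0.
Qed.

Lemma derive_commute_rV (V : normedModType R) m (U : set V) (f : V -> 'rV[R]_m) x u v :
  open U -> U x -> Ck 1 U f -> 'D_u ('D_v f) x = 'D_v ('D_u f) x.
Proof.
move=> oU Ux Cf; apply/rowP => i.
have Ci := Ck_coord i oU Cf.
pose fi y : R := f y 0 i.
have E w y : U y -> 'D_w f y 0 i = 'D_w fi y.
  by move=> Uy; symmetry; exact: (derive_coord i w (Ck_diff Cf Uy)).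
have E2 w w' : 'D_w' ('D_w f) x 0 i = 'D_w' ('D_w fi) x.
  transitivity ('D_w' (fun y => 'D_w f y 0 i) x).
    by symmetry; exact: (derive_coord i w' (Ck_diff (Ck_derive w Cf) Ux)).
  exact: (eq_on_derive w' oU Ux (E w)).
suff H : 'D_u ('D_v fi) x = 'D_v ('D_u fi) x by exact: (etrans (E2 v u) (etrans H (esym (E2 u v)))).
apply: (derive_commute oU Ux).
- by move=> y Uy; exact: Ck_diff Ci Uy.
- exact: (Ck_diff (Ck_derive u Ci) Ux).
- exact: (Ck_diff (Ck_derive v Ci) Ux).
Qed.

End Schwarz.

(** * Linear algebra of the Euclidean plane *)

Section Plane.
Context {R : realType}.
Local Notation P := 'rV[R]_2.
Local Notation d0 := (delta_mx 0 0 : P).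
Local Notation d1 := (delta_mx 0 1 : P).

Lemma sum_I2 (W : zmodType) (F : 'I_2 -> W) : \sum_i F i = F 0 + F 1.
Proof.
rewrite !big_ord_recl big_ord0 addr0; congr (_ + F _).
exact: val_inj.
Qed.

Lemma is_lin_plane (W : lmodType R) (f : P -> W) : is_lin f ->
  forall v, f v = v 0 0 *: f d0 + v 0 1 *: f d1.
Proof. by move=> lf v; rewrite is_lin_coord// sum_I2. Qed.

Definition det2 (u v : P) : R := u 0 0 * v 0 1 - u 0 1 * v 0 0.

Lemma alternating_det2 (W : lmodType R) (B : P -> P -> W) : is_bilin B ->
  (forall u, B u u = 0) -> forall u v, B u v = det2 u v *: B d0 d1.
Proof.
move=> [lB1 lB2] B0.
have B10 : B d1 d0 = - B d0 d1.
  apply/eqP; rewrite -addr_eq0; apply/eqP.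
  have := B0 (d0 + d1); rewrite (is_linD (lB2 _)) !(is_linD (lB1 _)) !B0 add0r addr0.
  by rewrite addrC.
move=> u v; rewrite (is_lin_plane (lB2 v)) !(is_lin_plane (lB1 _) v) !B0 B10.
rewrite !scaler0 add0r addr0 scalerN !scalerN !scalerA /det2 scalerBl.
by congr (_ - _ *: _); rewrite mulrC.
Qed.

Lemma det_plane (A : 'M[R]_2) : \det A = A 0 0 * A 1 1 - A 0 1 * A 1 0.
Proof.
rewrite (expand_det_row _ 0) sum_I2 /cofactor !det_mx11 !mxE /=.
rewrite expr0 mul1r expr1 mulN1r mulrN.
by congr (A _ _ * A _ _ - A _ _ * A _ _); apply: val_inj.
Qed.

Section Metric.
Variables (h : P -> P -> R) (j : P -> P).
Hypothesis h_bilin : is_bilin (W := R^o) h.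
Hypothesis h_sym : forall u v, h u v = h v u.
Hypothesis h_pos : forall u, u != 0 -> 0 < h u u.
Hypothesis j_lin : is_lin j.
Hypothesis jj : forall u, j (j u) = - u.
Hypothesis h_j : forall u v, h (j u) (j v) = h u v.

Let hl v : is_lin (W := R^o) (h^~ v) := h_bilin.2 v.
Let hr u : is_lin (W := R^o) (h u) := h_bilin.1 u.

Lemma h_jl u v : h (j u) v = - h u (j v).
Proof. by rewrite -h_j jj (is_linN (hl _)). Qed.

Lemma h_ju u : h (j u) u = 0.
Proof. by have := h_jl u u; rewrite [h u (j u)]h_sym => H; lra. Qed.

Lemma det2_j u : u != 0 -> det2 u (j u) != 0.
Proof.
move=> u0; have ju0 : 0 < h (j u) (j u) by rewrite h_j; exact: h_pos.
apply/eqP => d0; move: ju0.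
have B : is_bilin (W := R^o) (fun u v => h (j u) v).
  split=> [w|w] k x y; first exact: hr.
  by rewrite j_lin; exact: hl.
by rewrite (alternating_det2 B h_ju) d0 scale0r ltxx.
Qed.

Lemma alternating_eq (W : lmodType R) (B B' : P -> P -> W) :
  is_bilin B -> is_bilin B' -> (forall u, B u u = 0) -> (forall u, B' u u = 0) ->
  (forall u, B u (j u) = B' u (j u)) -> forall u v, B u v = B' u v.
Proof.
move=> lB lB' B0 B0' E u v.
rewrite (alternating_det2 lB)// [RHS](alternating_det2 lB')//; congr (_ *: _).
have d0n0 : d0 != 0.
  apply/eqP => /rowP /(_ 0); rewrite !mxE /= => /eqP; rewrite oner_eq0 //.
have := E d0; rewrite (alternating_det2 lB)// [RHS](alternating_det2 lB')//.
by apply: scalerI; exact: det2_j.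
Qed.

Lemma area_neq0 : h (j d0) d1 != 0.
Proof.
have d0n0 : d0 != 0.
  apply/eqP => /rowP /(_ 0); rewrite !mxE /= => /eqP; rewrite oner_eq0 //.
have ju0 : 0 < h (j d0) (j d0) by rewrite h_j; exact: h_pos.
have B : is_bilin (W := R^o) (fun u v => h (j u) v).
  split=> [w|w] k x y; first exact: hr.
  by rewrite j_lin; exact: hl.
apply/eqP => E; move: ju0.
by rewrite (alternating_det2 B h_ju) E scaler0 ltxx.
Qed.

Lemma alternating_area (W : lmodType R) (B : P -> P -> W) : is_bilin B ->
  (forall u, B u u = 0) ->
  forall u v, B u v = h (j u) v *: ((h (j d0) d1)^-1 *: B d0 d1).
Proof.
move=> lB B0 u v.
have A : is_bilin (W := R^o) (fun u v => h (j u) v).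
  split=> [w|w] k x y; first exact: hr.
  by rewrite j_lin; exact: hl.
rewrite (alternating_det2 lB)// (alternating_det2 A h_ju) scalerA; congr (_ *: _).
by rewrite -[_ *: _]/(_ * _) mulfK// area_neq0.
Qed.

Section Frame.
Variable e : 'I_2 -> P.
Hypothesis he : forall i k, h (e i) (e k) = (i == k)%:R.

Let G : 'M[R]_2 := \matrix_(i, k) h (delta_mx 0 i) (delta_mx 0 k).
Let Q : 'M[R]_2 := \matrix_(i, k) e i 0 k.

Lemma frame_matrix : Q *m G *m Q^T = 1%:M.
Proof.
apply/matrixP => i k; rewrite !mxE -he.
rewrite [in RHS](is_lin_coord (hl _)).
under [RHS]eq_bigr => l _ do rewrite (is_lin_coord (hr _)) scaler_sumr.
rewrite exchange_big /=; apply: eq_bigr => l _.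
rewrite !mxE mulr_suml; apply: eq_bigr => m _.
rewrite !mxE -![_ *: _]/(_ * _).
by rewrite mulrCA mulrC mulrA.
Qed.

Lemma frame_unit : Q \in unitmx.
Proof.
have /mulmx1_unit[] : Q *m (G *m Q^T) = 1%:M by rewrite mulmxA frame_matrix.
by [].
Qed.

Lemma frame_expand v : v = h v (e 0) *: e 0 + h v (e 1) *: e 1.
Proof.
have [w vw] : exists w : P, v = w 0 0 *: e 0 + w 0 1 *: e 1.
  exists (v *m invmx Q); rewrite -(sum_I2 (fun i => (v *m invmx Q) 0 i *: e i)).
  rewrite -{1}[v](mulmxKV frame_unit) mulmx_sum_row.
  by apply: eq_bigr => i _; congr (_ *: _); apply/rowP => k; rewrite !mxE.
rewrite {1}vw; congr (_ *: _ + _ *: _); rewrite vw !(is_linD (hl _)) !(is_linZ (hl _)) !he.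
- by rewrite -![_ *: _]/(_ * _) mulr1 mulr0 addr0.
- by rewrite -![_ *: _]/(_ * _) mulr1 mulr0 add0r.
Qed.

Lemma is_lin_frame (W : lmodType R) (f : P -> W) : is_lin f ->
  forall v, f v = h v (e 0) *: f (e 0) + h v (e 1) *: f (e 1).
Proof.
by move=> lf v; rewrite -!(is_linZ lf) -(is_linD lf) -frame_expand.
Qed.

Lemma frame_trace (B : P -> P -> R) : is_bilin (W := R^o) B ->
  \sum_i \sum_k invmx G i k * B (delta_mx 0 i) (delta_mx 0 k) =
  \sum_i B (e i) (e i).
Proof.
move=> [lB1 lB2].
have GQ : invmx G = Q^T *m Q.
  have Gu : G \in unitmx.
    have /mulmx1_unit[] : (Q *m G) *m Q^T = 1%:M by exact: frame_matrix.
    by rewrite unitmx_mul => /andP[].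
  have H : Q *m (G *m Q^T) = 1%:M by rewrite mulmxA frame_matrix.
  have := mulmx1C H => H'.
  rewrite -[LHS]mulmx1 -[RHS](mulKmx Gu); congr (_ *m _).
  by rewrite mulmxA H'.
transitivity (\sum_l \sum_i \sum_k Q l i * Q l k * B (delta_mx 0 i) (delta_mx 0 k)).
  rewrite [RHS]exchange_big /=; apply: eq_bigr => i _.
  rewrite [RHS]exchange_big /=; apply: eq_bigr => k _.
  by rewrite GQ !mxE mulr_suml; apply: eq_bigr => l _; rewrite !mxE.
apply: eq_bigr => l _.
rewrite [RHS](is_lin_coord (lB2 _)); apply: eq_bigr => i _.
rewrite [RHS](_ : _ = e l 0 i * \sum_k e l 0 k *: B (delta_mx 0 i) (delta_mx 0 k));
  last by rewrite -is_lin_coord.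
by rewrite mulr_sumr; apply: eq_bigr => k _; rewrite !mxE mulrA.
Qed.

Lemma frame_det : det2 (e 0) (e 1) ^+ 2 * \det G = 1.
Proof.
have dQ : \det Q = det2 (e 0) (e 1) by rewrite det_plane !mxE.
have := congr1 (fun M => \det M) frame_matrix.
by rewrite !det_mulmx det_tr det1 dQ expr2 => <-; ring.
Qed.

Lemma frame_j : exists2 s : R, s * s = 1 & j (e 0) = s *: e 1 /\ j (e 1) = - s *: e 0.
Proof.
exists (h (j (e 0)) (e 1)).
- have := h_j (e 0) (e 0); rewrite he {2}(frame_expand (j (e 0))) h_ju scale0r add0r.
  by rewrite (is_linZ (hr _)) eqxx.
- split; first by rewrite {1}(frame_expand (j (e 0))) h_ju scale0r add0r.
  rewrite {1}(frame_expand (j (e 1))) h_ju scale0r addr0.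
  by rewrite h_jl h_sym.
Qed.

Lemma trace_j (W : lmodType R) (B : P -> P -> W) : is_bilin B ->
  \sum_i B (e i) (j (e i)) = - \sum_i B (j (e i)) (e i).
Proof.
move=> [lB1 lB2]; have [s _ [j0 j1]] := frame_j.
rewrite !sum_I2 !j0 !j1 !(is_linZ (lB1 _)) !(is_linZ (lB2 _)).
by rewrite !scaleNr opprD opprK addrC.
Qed.

Lemma j_invariant_trace (B : P -> P -> R) : is_bilin (W := R^o) B ->
  (forall u v, B u v = B v u) -> (forall u v, B (j u) (j v) = B u v) ->
  forall u v, B u v = 2^-1 * (\sum_i B (e i) (e i)) * h u v.
Proof.
move=> [lB1 lB2] sB jB u v.
have [s ss [j0 j1]] := frame_j.
have s0 : s != 0 by apply/eqP => s0; move: ss; rewrite s0 mul0r => /esym/eqP; rewrite oner_eq0.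
have B11 : B (e 1) (e 1) = B (e 0) (e 0).
  rewrite -[RHS]jB j0 (is_linZ (lB1 _)) (is_linZ (lB2 _)).
  by rewrite -![_ *: _]/(_ * _) mulrA ss mul1r.
have B01 : B (e 0) (e 1) = 0.
  have : B (e 0) (j (e 0)) = 0.
    have := jB (e 0) (j (e 0)); rewrite jj (is_linN (lB1 _)) sB => H; lra.
  rewrite j0 (is_linZ (lB1 _)) => /eqP; rewrite -[_ *: _]/(_ * _) mulf_eq0 (negPf s0).
  by move/eqP.
rewrite sum_I2 (is_lin_frame (lB2 v)) !(is_lin_frame (lB1 _) v).
rewrite (sB (e 1) (e 0)) B01 B11 (is_lin_frame (hl v) u) !(h_sym (e _) v) -![_ *: _]/(_ * _).
by field.
Qed.

End Frame.

Lemma frame_exists : exists e : 'I_2 -> P, forall i k, h (e i) (e k) = (i == k)%:R.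
Proof.
have d0n0 : d0 != 0.
  apply/eqP => /rowP /(_ 0); rewrite !mxE /= => /eqP; rewrite oner_eq0 //.
have hp := h_pos d0n0.
pose r := Num.sqrt (h d0 d0); have r0 : 0 < r by rewrite sqrtr_gt0.
have rr : r * r = h d0 d0 by rewrite -expr2 sqr_sqrtr ?ltW.
pose e0 := r^-1 *: d0.
have e00 : h e0 e0 = 1.
  rewrite /e0 (is_linZ (hl _)) (is_linZ (hr _)) -![_ *: _]/(_ * _) -rr.
  by field; rewrite gt_eqF.
have e01 : h e0 (j e0) = 0 by rewrite h_sym h_ju.
exists (fun i => if i == 0 then e0 else j e0) => i k.
case: i => [[|[|//]]] ?; case: k => [[|[|//]]] ? /=; rewrite ?h_j ?e00 ?e01 ?h_ju//.
Qed.

End Metric.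
End Plane.

(** * Levi-Civita calculus on a Riemann surface *)

Ltac row_ring := apply/rowP => ?; rewrite !mxE; ring.

Section ConstantFields.
Context {R : realType} {m : nat}.
Local Notation E := 'rV[R]_m.

Lemma smooth_on_cst (W : normedModType R) (U : set E) (c : W) : smooth_on U (cst c).
Proof.
move=> s x _; suff [c' ->] : exists c', iter_derive (cst c) s = cst c'.
  exact: differentiable_cst.
elim: s => [|v s [c' IH]]; first by exists c.
by exists 0; rewrite /= IH; apply/funext => y; rewrite derive_cst.
Qed.

Lemma nabla_cst (G : E -> E -> E -> E) u v : nabla G (cst u) (cst v) = fun y => G y u v.
Proof. by apply/funext => y; rewrite /nabla derive_cst add0r. Qed.

Lemma lie_bracket_cst (u v : E) : lie_bracket (cst u) (cst v) = cst 0.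
Proof. by apply/funext => y; rewrite /lie_bracket !derive_cst subrr. Qed.

Lemma torsionE (G : E -> E -> E -> E) X Y y :
  torsion G X Y y = G y (X y) (Y y) - G y (Y y) (X y).
Proof.
rewrite /torsion /nabla /lie_bracket opprB.
set a := 'D_(X y) Y y; set b := 'D_(Y y) X y; set c := G _ _ _; set d := G _ _ _.
clearbody a b c d; row_ring.
Qed.

End ConstantFields.

Section SurfaceCalculus.
Context {R : realType} {S : riemann_surface R}.
Context {h : kahler_metric S} {D : connection S} (HD : levi_civita h D) (a : chart S).
Local Notation P := 'rV[R]_2.
Local Notation d_ i := (delta_mx 0 i : P).
Local Notation j := (rs_j S a).
Local Notation img := (chart_img a).

Section Pointwise.
Context {y : P} (Uy : img y).

Lemma h_bilin : is_bilin (W := R^o) (h a y).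
Proof.
split=> [u|v] k x z; first exact: (@rm_scalar _ _ _ h a y u Uy).
by rewrite !(@rm_sym _ _ _ h a y _ v Uy); exact: (@rm_scalar _ _ _ h a y v Uy).
Qed.

Lemma h_sym u v : h a y u v = h a y v u.
Proof. exact: rm_sym. Qed.

Lemma h_pos u : u != 0 -> 0 < h a y u u.
Proof. exact: rm_pos. Qed.

Lemma j_lin : is_lin (j y).
Proof. exact: ef_linear. Qed.

Lemma jj u : j y (j y u) = - u.
Proof. exact: rs_j_sqr. Qed.

Lemma h_j u v : h a y (j y u) (j y v) = h a y u v.
Proof. exact: km_invariant. Qed.

Lemma D_linl v : is_lin (fun u => D a y u v).
Proof. exact: cn_linearl. Qed.

Lemma D_linr u : is_lin (D a y u).
Proof. exact: cn_linearr. Qed.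

Lemma D_sym u v : D a y u v = D a y v u.
Proof.
have [T _] := HD (smooth_on_cst u) (smooth_on_cst v) (smooth_on_cst v) Uy.
by apply/eqP; rewrite -subr_eq0; rewrite torsionE in T; apply/eqP.
Qed.

Lemma h_parallel u v w :
  'D_u (fun y => h a y v w) y = h a y (D a y u v) w + h a y v (D a y u w).
Proof.
have [_ T] := HD (smooth_on_cst u) (smooth_on_cst v) (smooth_on_cst w) Uy.
by rewrite !nabla_cst in T.
Qed.

End Pointwise.

Lemma Ck_h n u v : Ck n img (fun y => h a y u v).
Proof. by apply: smooth_on_Ck; exact: rm_smooth. Qed.

Lemma Ck_j n u : Ck n img (fun y => j y u).
Proof. by apply: smooth_on_Ck; exact: ef_smooth. Qed.

Lemma Ck_D n u v : Ck n img (fun y => D a y u v).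
Proof. by apply: smooth_on_Ck; exact: cn_smooth. Qed.

Let oI : open img := @chart_img_open _ _ _ a.

Let diff_h y u v : img y -> differentiable (fun y => h a y u v) y.
Proof. exact: (Ck_diff (Ck_h 0 u v)). Qed.

Let diff_j y u : img y -> differentiable (fun y => j y u) y.
Proof. exact: (Ck_diff (Ck_j 0 u)). Qed.

Lemma derive_h (X : P -> P) y u w : img y -> differentiable X y ->
  differentiable (fun z => h a z (X z) w) y /\
  'D_u (fun z => h a z (X z) w) y =
    h a y (D a y u (X y)) w + h a y (X y) (D a y u w) + h a y ('D_u X y) w.
Proof.
move=> Uy dX.
have [||//|d1 d2] := @differentiable_lin R P R^o 2 (fun z v => h a z v w) X y.
- by apply: (near_open oI Uy) => z Uz; exact: (h_bilin Uz).2.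
- by move=> v; exact: diff_h.
by split => //; rewrite d2 h_parallel.
Qed.

(* [T], the covariant derivative of [j], is skew for [h] and anticommutes with
   [j]; in dimension two this forces [T = 0]. *)
Lemma j_parallel y z u : img y ->
  'D_z (fun y => j y u) y = j y (D a y z u) - D a y z (j y u).
Proof.
move=> Uy.
pose T u := 'D_z (fun y => j y u) y + D a y z (j y u) - j y (D a y z u).
have TE v : 'D_z (fun y => j y v) y = T v + j y (D a y z v) - D a y z (j y v).
  by rewrite /T subrK addrK.
have lT : is_lin T.
  move=> k v w; rewrite /T (j_lin Uy) !(D_linr Uy) (j_lin Uy).
  rewrite (is_lin_derive_param z oI Uy (fun y Uy => j_lin Uy) (fun v => diff_j v Uy)).
  set A := 'D_z _ _; set B := 'D_z _ _; set A' := D a y z _; set B' := D a y z (j y w).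
  set A2 := j y (D a y z v); set B2 := j y _; clearbody A B A' B' A2 B2.
  by row_ring.
clearbody T.
have hl := (h_bilin Uy).2; have hr := (h_bilin Uy).1.
have hJ v w := h_jl (h_bilin Uy) (jj Uy) (h_j Uy) v w.
have Tskew v w : h a y (T v) w = - h a y v (T w).
  have [d1 E1] := derive_h z w Uy (diff_j v Uy).
  have [d2 E2] := derive_h z v Uy (diff_j w Uy).
  have E : 'D_z ((fun x => h a x (j x v) w) + (fun x => h a x (j x w) v)) y = 0.
    rewrite (eq_on_derive z oI Uy (g := cst 0)) ?derive_cst// => x Ux.
    rewrite -[LHS]/(h a x (j x v) w + h a x (j x w) v).
    rewrite (h_jl (h_bilin Ux) (jj Ux) (h_j Ux)) (h_sym Ux _ v).
    by rewrite addNr.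
  move: E; rewrite deriveD; [|exact: diff_derivable|exact: diff_derivable].
  rewrite E1 E2 !TE !(is_linB (hl _)) !(is_linD (hl _)).
  have k1 := hJ (D a y z v) w; have k2 := hJ (D a y z w) v.
  have k3 := h_sym Uy (j y v) (D a y z w); have k4 := h_sym Uy (j y w) (D a y z v).
  have k5 := h_sym Uy (T w) v.
  move=> H; lra.
have Tj v : T (j y v) = - j y (T v).
  have : 'D_z (fun x => j x (j x v)) y = 0.
    rewrite (eq_on_derive z oI Uy (g := cst (- v))) ?derive_cst// => x Ux.
    exact: jj.
  have [||//|_ ->] := @differentiable_lin R P P 2 (fun x w => j x w) (fun x => j x v) y.
  - by apply: (near_open oI Uy) => x Ux; exact: j_lin.
  - by move=> w; exact: diff_j.
  - exact: diff_j.
  rewrite !TE (jj Uy) (is_linB (j_lin Uy)) (is_linD (j_lin Uy)) (jj Uy) (is_linN (D_linr Uy z)).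
  rewrite opprK => /eqP; set A := T _; set B := j y (T v); set K := j y (D _ _ _ _).
  set L := D a y z v; clearbody A B K L.
  move/eqP => H; apply/eqP; rewrite -addr_eq0 -H; apply/eqP; row_ring.
have T1 v : h a y (T v) v = 0.
  by have := Tskew v v; rewrite [h a y v _](h_sym Uy) => H; lra.
have T2 v : h a y (T v) (j y v) = 0.
  have := Tskew v (j y v); rewrite Tj (is_linN (hr _)).
  have := hJ v (T v); rewrite (h_sym Uy (j y v)) => H1 H2; lra.
have [e he] := frame_exists (h_bilin Uy) (h_sym Uy) (h_pos Uy) (jj Uy) (h_j Uy).
have [s ss [j0 j1]] := frame_j (h_bilin Uy) (h_sym Uy) (jj Uy) (h_j Uy) he.
have s0 : s != 0 by apply/eqP => s0; move: ss; rewrite s0 mul0r => /esym/eqP; rewrite oner_eq0.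
have T01 : h a y (T (e 0)) (e 1) = 0.
  have := T2 (e 0); rewrite j0 (is_linZ (hr _)) => /eqP.
  by rewrite -[_ *: _]/(_ * _) mulf_eq0 (negPf s0) => /eqP.
have T10 : h a y (T (e 1)) (e 0) = 0.
  have := T2 (e 1); rewrite j1 (is_linZ (hr _)) => /eqP.
  by rewrite -[_ *: _]/(_ * _) mulf_eq0 oppr_eq0 (negPf s0) => /eqP.
have T0 v : T v = 0.
  rewrite (is_lin_frame (h_bilin Uy) he lT v).
  rewrite (frame_expand (h_bilin Uy) he (T (e 0))) (frame_expand (h_bilin Uy) he (T (e 1))).
  by rewrite !T1 T01 T10 !scale0r !addr0 !scaler0 addr0.
by rewrite TE T0 add0r.
Qed.


End SurfaceCalculus.

Section SurfaceCurvature.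
Context {R : realType} {S : riemann_surface R}.
Context {h : kahler_metric S} {D : connection S} (HD : levi_civita h D) (a : chart S).
Local Notation P := 'rV[R]_2.
Local Notation d_ i := (delta_mx 0 i : P).
Local Notation j := (rs_j S a).
Local Notation img := (chart_img a).

Let oI : open img := @chart_img_open _ _ _ a.

Lemma area_parallel y z u v : img y ->
  'D_z (fun y => h a y (j y u) v) y =
  h a y (j y (D a y z u)) v + h a y (j y u) (D a y z v).
Proof.
move=> Uy; have [_ ->] := derive_h HD z v Uy (Ck_diff (Ck_j a 0 u) Uy).
rewrite (j_parallel HD z u Uy) (is_linB ((h_bilin Uy).2 v)).
by rewrite addrC addrA subrK.
Qed.

Definition riem (y u v w : P) : P :=
  'D_u (fun y => D a y v w) y + D a y u (D a y v w)
  - ('D_v (fun y => D a y u w) y + D a y v (D a y u w)).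

Lemma curvature_cst y u v w : img y ->
  curvature (D a) (cst u) (cst v) (cst w) y = riem y u v w.
Proof.
move=> Uy; rewrite /curvature !nabla_cst lie_bracket_cst /nabla /=.
by rewrite (@derive0 _ _ _ (cst w)) (is_lin0 (D_linl Uy w)) addr0 subr0.
Qed.

Lemma riem_alternating y u w : riem y u u w = 0.
Proof. exact: subrr. Qed.

Lemma riem_linl y v w : img y -> is_lin (fun u => riem y u v w).
Proof.
move=> Uy k u u'; rewrite /riem.
rewrite (is_lin_derive (Ck_diff (Ck_D a 0 v w) Uy)) (D_linl Uy) (D_linl Uy w).
rewrite (is_lin_derive_param v oI Uy (fun y Uy => @D_linl _ _ D a y Uy w)); last first.
  by move=> t; exact: (Ck_diff (Ck_D a 0 t w) Uy).
rewrite (D_linr Uy).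
set A := 'D_u _ _; set B := 'D_u' _ _; set C := D a y u _; set E := D a y u' _.
set A1 := 'D_v _ _; set B1 := 'D_v _ _; set C1 := D a y v _; set E1 := D a y v _.
by clearbody A B C E A1 B1 C1 E1; row_ring.
Qed.

Lemma riem_anti y u v w : riem y u v w = - riem y v u w.
Proof. by rewrite /riem opprB. Qed.

Lemma riem_linm y u w : img y -> is_lin (fun v => riem y u v w).
Proof.
by move=> Uy k v v'; rewrite !(riem_anti y u) (riem_linl _ _ Uy) opprD scalerN.
Qed.

Lemma riem_linr y u v : img y -> is_lin (riem y u v).
Proof.
move=> Uy k w w'; rewrite /riem !(D_linr Uy).
rewrite (is_lin_derive_param u oI Uy (fun y Uy => @D_linr _ _ D a y Uy v)); last first.
  by move=> t; exact: (Ck_diff (Ck_D a 0 v t) Uy).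
rewrite (is_lin_derive_param v oI Uy (fun y Uy => @D_linr _ _ D a y Uy u)); last first.
  by move=> t; exact: (Ck_diff (Ck_D a 0 u t) Uy).
set A := 'D_u _ _; set B := 'D_u _ _; set C := D a y u _; set E := D a y u _.
set A1 := 'D_v _ _; set B1 := 'D_v _ _; set C1 := D a y v _; set E1 := D a y v _.
by clearbody A B C E A1 B1 C1 E1; row_ring.
Qed.

Lemma riem_skew y u v w : img y -> h a y (riem y u v w) w = 0.
Proof.
move=> Uy; have hl := (h_bilin (h := h) Uy).2 w.
have DD s t : 'D_s ('D_t (fun x => h a x w w)) y =
   2 * (h a y (D a y s (D a y t w)) w + h a y (D a y t w) (D a y s w)
     + h a y ('D_s (fun x => D a x t w) y) w).
  rewrite (eq_on_derive s oI Uy (g := fun x => 2 *: h a x (D a x t w) w)); last first.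
    move=> x Ux; rewrite (h_parallel HD Ux) (h_sym Ux w).
    by rewrite -[RHS]/(2 * _); ring.
  have [d1 E] := derive_h HD (X := fun x => D a x t w) s w Uy (Ck_diff (Ck_D a 0 t w) Uy).
  by rewrite deriveZ; [rewrite E|exact: diff_derivable].
have Ch := @Ck_h _ _ h a 1 w w.
have dh := fun x Ux => Ck_diff Ch (x := x) Ux.
have := derive_commute oI Uy dh (Ck_diff (Ck_derive u Ch) Uy) (Ck_diff (Ck_derive v Ch) Uy).
rewrite !DD /riem !(is_linB hl, is_linD hl) (h_sym Uy (D a y u w)).
set A := h a y _ _; set B := h a y _ _; set E := h a y _ _; set A' := h a y _ _.
set E' := h a y _ _; clearbody A B E A' E' => H; lra.
Qed.

Lemma riem_trace y (e : 'I_2 -> P) : img y -> orthonormal_frame h a y e ->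
  \sum_z \sum_u h a y (riem y (e z) (e u) (e z)) (e u) = - 2 * gauss_curvature h D a y.
Proof.
move=> Uy he; have [hr hl] := h_bilin (h := h) Uy.
pose R4 u v w t := h a y (riem y u v w) t.
have R4l w t : is_bilin (W := R^o) (fun u v => R4 u v w t).
  split=> [u|v] k x x'; rewrite /R4.
    by rewrite (riem_linm _ _ Uy); exact: hl.
  by rewrite (riem_linl _ _ Uy); exact: hl.
have R4r u v : is_bilin (W := R^o) (fun w t => R4 u v w t).
  split=> [w|t] k x x'; rewrite /R4; first exact: hr.
  by rewrite (riem_linr _ _ Uy); exact: hl.
have R4E u v w t : R4 u v w t = det2 u v * (det2 w t * R4 (d_ 0) (d_ 1) (d_ 0) (d_ 1)).
  rewrite (alternating_det2 (R4l w t)); last first.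
    by move=> z; rewrite /R4 riem_alternating; exact: (is_lin0 (hl _)).
  rewrite (alternating_det2 (R4r _ _))// => z; exact: (riem_skew _ _ _ Uy).
have K : gauss_curvature h D a y = - R4 (d_ 0) (d_ 1) (d_ 0) (d_ 1) / \det (gram h a y).
  rewrite /gauss_curvature curvature_cst//; congr (_ / _).
  rewrite -[LHS]/(R4 (d_ 0) (d_ 1) (d_ 1) (d_ 0)) R4E [in RHS]R4E /det2 !mxE /=.
  ring.
have fd := frame_det (h_bilin Uy) he.
have G0 : \det (gram h a y) != 0.
  by apply/eqP => G0; move: fd; rewrite -/(gram h a y) G0 mulr0 => /esym/eqP; rewrite oner_eq0.
rewrite !sum_I2 K !riem_alternating !(is_lin0 (hl _)).
rewrite -/(R4 (e 0) (e 1) (e 0) (e 1)) -/(R4 (e 1) (e 0) (e 1) (e 0)).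
rewrite (R4E (e 0) (e 1) (e 0) (e 1)) (R4E (e 1) (e 0) (e 1) (e 0)).
move: fd; rewrite -/(gram h a y) => fd.
have -> : det2 (e 1) (e 0) = - det2 (e 0) (e 1) by rewrite /det2; ring.
set r := R4 _ _ _ _; set d := det2 _ _ in fd *; set g := \det _ in G0 fd *.
clearbody r d g.
transitivity (2 * (r * (d ^+ 2 * g)) / g); first by field.
by rewrite fd; field.
Qed.

Section Hessian.
Context {U : set P} {f : P -> R} (oU : open U) (UI : forall x, U x -> img x) (Cf : Ck 1 U f).

Definition hess (y z w : P) : R := 'D_z ('D_w f) y - 'D_(D a y z w) f y.

Lemma hess_bilin y : U y -> is_bilin (W := R^o) (hess y).
Proof.
move=> Uy; have df := Ck_diff Cf Uy; split=> [z|w] k u v; rewrite /hess.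
  have dD t : differentiable ('D_t f) y by exact: (Ck_diff (Ck_derive t Cf) Uy).
  rewrite (is_lin_derive_param z oU Uy (F := fun y w => 'D_w f y)).
  - by rewrite (D_linr (UI Uy)) (is_lin_derive df); exact: scaleDB.
  - by move=> x Ux; apply: is_lin_derive; exact: (Ck_diff Cf Ux).
  - exact: dD.
rewrite (is_lin_derive (Ck_diff (Ck_derive w Cf) Uy)) (D_linl (UI Uy)) (is_lin_derive df).
exact: scaleDB.
Qed.

Lemma laplacian_hess y (e : 'I_2 -> P) : U y -> orthonormal_frame h a y e ->
  laplacian h a f y = - \sum_i hess y (e i) (e i).
Proof.
move=> Uy he; have Iy := UI Uy; have df := Ck_diff Cf Uy.
have E z w : 'D_z (fun x => - 'D_(j x w) f x) y =
    - (hess y z (j y w) + 'D_(j y (D a y z w)) f y).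
  have [||/=|d1 E1] := @differentiable_lin R P R^o 2 (fun x v => 'D_v f x) (fun x => j x w) y.
  - by apply: (near_open oU Uy) => x Ux; apply: is_lin_derive; exact: (Ck_diff Cf Ux).
  - by move=> v; exact: (Ck_diff (Ck_derive v Cf) Uy).
  - exact: (Ck_diff (Ck_j a 0 w) Iy).
  rewrite (@deriveN _ _ _ (fun x => 'D_(j x w) f x)); last exact: diff_derivable.
  rewrite E1 (j_parallel HD z w Iy) (is_linB (is_lin_derive df)) /hess.
  by rewrite addrA addrAC.
pose A u v := hess y u (j y v) - hess y v (j y u).
have [hb1 hb2] := hess_bilin Uy.
have lA : is_bilin (W := R^o) A.
  split=> [u|v] k x x'; rewrite /A (j_lin Iy) ?(hb2 (j y u)) ?(hb1 u) ?(hb1 v) ?(hb2 (j y v));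
  exact: scaleDB.
have A0 u : A u u = 0 by exact: subrr.
have LA : laplacian h a f y = (h a y (j y (d_ 0)) (d_ 1))^-1 * A (d_ 0) (d_ 1).
  rewrite /laplacian /codiff /star2 /ext_d /star1 !E (D_sym HD Iy (d_ 1)) /A /area_form.
  rewrite -[_ *: _]/(_ * _); set p := 'D_(j y _) f y; set q := hess _ _ _; set r := hess _ _ _.
  set g := h _ _ _ _; clearbody p q r g; ring.
have AA : A (e 0) (e 1) = h a y (j y (e 0)) (e 1) * laplacian h a f y.
  rewrite LA; exact: (alternating_area (h_bilin Iy) (h_sym Iy) (h_pos Iy) (j_lin Iy) (jj Iy) (h_j Iy) lA A0).
have [s ss [j0 j1]] := frame_j (h_bilin Iy) (h_sym Iy) (jj Iy) (h_j Iy) he.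
move: AA; rewrite /A j0 j1.
rewrite !(is_linZ (hb1 _)) (is_linZ ((h_bilin Iy).2 _)) he eqxx sum_I2.
rewrite -![_ *: _]/(_ * _) => AA.
have -> : laplacian h a f y = s * (s * 1%:R * laplacian h a f y) by rewrite mulr1 mulrA ss mul1r.
rewrite -AA.
set x0 := hess _ _ _; set x1 := hess _ _ _; clearbody x0 x1.
rewrite (_ : s * _ = - (s * s) * (x0 + x1)); last by ring.
by rewrite ss mulN1r.
Qed.

End Hessian.
End SurfaceCurvature.

Arguments hess {R S} D a f y z w.
Arguments riem {R S} D a y u v w.

(** * Contact triads at a point *)

Section ContactPointwise.
Context {R : realType} {n : nat} {M : manifold R n.*2.+1}.
Context {C : contact_triad M} {nab : connection M} (Hnab : triad_connection C nab).
Context (b : chart M).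
Local Notation E := 'rV[R]_(n.*2.+1).
Local Notation img := (chart_img b).
Local Notation l := (lambda C b).
Local Notation X := (reeb C b).
Local Notation J := (ctJ C b).
Local Notation G := (nab b).
Local Notation pi := (xi_proj C b).

Let oI : open img := @chart_img_open _ _ _ b.

Section AtPoint.
Context {z : E} (Uz : img z).

Lemma lambda_lin : is_lin (W := R^o) (l z).
Proof. exact: of_scalar. Qed.

Lemma ctJ_lin : is_lin (J z).
Proof. exact: ef_linear. Qed.

Lemma nab_bilin : is_bilin (G z).
Proof. by split=> v; [exact: cn_linearr|exact: cn_linearl]. Qed.

Lemma xi_proj_lin : is_lin (pi z).
Proof.
move=> k u v; rewrite /xi_proj lambda_lin scalerDl -[k *: l z u]/(k * l z u).
by rewrite -scalerA; exact: scaleDB.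
Qed.

Lemma lambda_xi_proj v : l z (pi z v) = 0.
Proof.
rewrite /xi_proj (is_linB lambda_lin) (is_linZ lambda_lin) lambda_reeb//.
by rewrite -[_ *: _]/(_ * _) mulr1 subrr.
Qed.

Lemma xi_proj_xi v : l z v = 0 -> pi z v = v.
Proof. by move=> lv; rewrite /xi_proj lv scale0r subr0. Qed.

Lemma xi_proj_reeb : pi z (X z) = 0.
Proof. by rewrite /xi_proj lambda_reeb// scale1r subrr. Qed.

Lemma ctJ_xi_proj v : J z (pi z v) = J z v.
Proof. by rewrite /xi_proj (is_linB ctJ_lin) (is_linZ ctJ_lin) ctJ_reeb// scaler0 subr0. Qed.

Lemma lambda_ctJ v : l z (J z v) = 0.
Proof. by rewrite -ctJ_xi_proj ctJ_xi// lambda_xi_proj. Qed.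

End AtPoint.

Lemma Ck_lambda k v : Ck k img (fun z => l z v).
Proof. by apply: smooth_on_Ck; exact: of_smooth. Qed.

Lemma Ck_reeb k : Ck k img X.
Proof. by apply: smooth_on_Ck; exact: vf_smooth. Qed.

Lemma Ck_ctJ k v : Ck k img (fun z => J z v).
Proof. by apply: smooth_on_Ck; exact: ef_smooth. Qed.

Lemma Ck_nab k u v : Ck k img (fun z => G z u v).
Proof. by apply: smooth_on_Ck; exact: cn_smooth. Qed.

Lemma Ck_xi_proj k v : Ck k img (fun z => pi z v).
Proof.
apply: CkB => //; first exact: Ck_cst.
by apply: Ck_scale => //; [exact: Ck_lambda|exact: Ck_reeb].
Qed.

Lemma xi_section_xi_proj v : xi_section C b (fun z => pi z v).
Proof.
split; first by apply: Ck_smooth_on => k; exact: Ck_xi_proj.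
by move=> z Uz; exact: lambda_xi_proj.
Qed.

Lemma ext_d_bilin z : img z -> is_bilin (W := R^o) (ext_d l z).
Proof.
move=> Uz.
have H v : is_lin (W := R^o) (fun u => 'D_u (fun y => l y v) z).
  exact: (is_lin_derive (Ck_diff (Ck_lambda 0 v) Uz)).
have H' u : is_lin (W := R^o) (fun v => 'D_u (fun y => l y v) z).
  apply: (is_lin_derive_param u oI Uz (F := fun y v => l y v)).
    by move=> y Uy; exact: lambda_lin.
  by move=> v; exact: (Ck_diff (Ck_lambda 0 v) Uz).
split=> [u|v] k x y; rewrite /ext_d.
  by rewrite (H' u) (H u); exact: scaleDB.
by rewrite (H' v) (H v); exact: scaleDB.
Qed.

Lemma Ck_ext_d k u v : Ck k img (fun z => ext_d l z u v).
Proof.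
by apply: CkB => //; [exact: (Ck_derive u (Ck_lambda k.+1 v))|exact: (Ck_derive v (Ck_lambda k.+1 u))].
Qed.

Lemma g_xi_bilin z : img z -> is_bilin (W := R^o) (g_xi C b z).
Proof.
move=> Uz; split=> [u|v] k x y; rewrite /g_xi.
  by rewrite (ctJ_lin Uz); exact: (ext_d_bilin Uz).1.
exact: (ext_d_bilin Uz).2.
Qed.

Lemma Ck_g_xi k u v : Ck k img (fun z => g_xi C b z u v).
Proof.
apply: (Ck_lin (F := fun z w => ext_d l z u w)) => //.
- by move=> y Uy; exact: (ext_d_bilin Uy).1.
- by move=> w; exact: Ck_ext_d.
- exact: Ck_ctJ.
Qed.

Lemma triad_metric_bilin z : img z -> is_bilin (W := R^o) (triad_metric C b z).
Proof.
move=> Uz; have [hr hl] := g_xi_bilin Uz.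
split=> [u|v] k x y; rewrite /triad_metric (xi_proj_lin Uz) (lambda_lin Uz).
  rewrite hr -![_ *: _]/(_ * _); set p := g_xi _ _ _ _ _; set q := g_xi _ _ _ _ _.
  by set r := l z _; set r1 := l z _; set r2 := l z _; clearbody p q r r1 r2; ring.
rewrite (hl _ k) -![_ *: _]/(_ * _); set p := g_xi _ _ _ _ _; set q := g_xi _ _ _ _ _.
by set r := l z _; set r1 := l z _; set r2 := l z _; clearbody p q r r1 r2; ring.
Qed.

Lemma triad_metric_xil z v w : img z -> l z w = 0 ->
  triad_metric C b z v w = g_xi C b z (pi z v) w.
Proof. by move=> Uz lw; rewrite /triad_metric lw mulr0 addr0 (xi_proj_xi lw). Qed.

Lemma triad_metric_xir z v w : img z -> l z v = 0 ->
  triad_metric C b z v w = g_xi C b z v (pi z w).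
Proof. by move=> Uz lv; rewrite /triad_metric lv mul0r addr0 (xi_proj_xi lv). Qed.

Lemma Ck_triad_metric k u v : Ck k img (fun z => triad_metric C b z u v).
Proof.
apply: CkD => //; last by apply: (@Ck_scale _ _ R^o) => //; exact: Ck_lambda.
apply: (Ck_lin (F := fun z w => g_xi C b z (pi z u) w)) => //.
- by move=> y Uy; exact: (g_xi_bilin Uy).1.
- move=> w; apply: (Ck_lin (F := fun z t => g_xi C b z t w)) => //.
  + by move=> y Uy; exact: (g_xi_bilin Uy).2.
  + by move=> t; exact: Ck_g_xi.
  + exact: Ck_xi_proj.
- exact: Ck_xi_proj.
Qed.

Lemma triad_metric_parallel z u v w : img z ->
  'D_u (fun z => triad_metric C b z v w) z =
  triad_metric C b z (G z u v) w + triad_metric C b z v (G z u w).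
Proof.
move=> Uz; have := tc_metric Hnab (smooth_on_cst u) (smooth_on_cst v) (smooth_on_cst w) Uz.
by rewrite !nabla_cst.
Qed.

Lemma g_xi_ctJ z u v : img z -> l z u = 0 -> l z v = 0 ->
  g_xi C b z (J z u) (J z v) = g_xi C b z u v.
Proof. by move=> *; exact: gxi_invariant. Qed.

Lemma g_xi_sym z u v : img z -> l z u = 0 -> l z v = 0 ->
  g_xi C b z u v = g_xi C b z v u.
Proof. by move=> *; exact: gxi_sym. Qed.

Lemma ctJ_derive_xi_proj z u v : img z -> l z v = 0 ->
  J z ('D_u (fun y => pi y v) z) = 0.
Proof.
move=> Uz lv.
have dX := Ck_diff (Ck_reeb 0) Uz; have dl := Ck_diff (Ck_lambda 0 v) Uz.
have [dlX _] := differentiable_scale dl dX.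
have E : 'D_u (fun y => pi y v) z = - 'D_u (fun y => l y v *: X y) z.
  transitivity ('D_u (cst v + - (fun y => l y v *: X y)) z) => //.
  rewrite deriveD; [|exact: derivable_cst|by apply: derivableN; exact: diff_derivable].
  by rewrite derive_cst add0r deriveN//; exact: diff_derivable.
rewrite E; have [_ ->] := differentiable_scale dl dX.
rewrite lv scale0r add0r (is_linN (ctJ_lin Uz)) (is_linZ (ctJ_lin Uz)).
by rewrite ctJ_reeb// scaler0 oppr0.
Qed.

Lemma hermitian_ctJ z u v : img z -> l z v = 0 ->
  pi z ('D_u (fun y => J y v) z + G z u (J z v)) = J z (G z u v).
Proof.
move=> Uz lv.
have E : 'D_u (fun y => J y (pi y v)) z = 'D_u (fun y => J y v) z.
  by apply: (eq_on_derive u oI Uz) => y Uy; rewrite ctJ_xi_proj.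
have := tc_hermitian_J Hnab (smooth_on_cst u) (xi_section_xi_proj v) Uz.
rewrite /nabla /= (ctJ_xi_proj Uz) (xi_proj_xi lv) (ctJ_xi_proj Uz) (is_linD (ctJ_lin Uz)).
by rewrite (ctJ_derive_xi_proj u Uz lv) add0r => <-; rewrite E.
Qed.

Definition nabla_reeb (z v : E) : E := 'D_v X z + G z v (X z).

Section NablaReeb.
Context {z : E} (Uz : img z).
Local Notation A := (nabla_reeb z).

Lemma nabla_reeb_lin : is_lin A.
Proof.
move=> k u v; rewrite /nabla_reeb (is_lin_derive (Ck_diff (Ck_reeb 0) Uz)).
by rewrite ((nab_bilin Uz).2 (X z)); exact: scaleDD.
Qed.

Lemma nabla_reeb_reeb : A (X z) = 0.
Proof. exact: (tc_reeb_reeb Hnab Uz). Qed.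

Lemma nabla_reeb_xi_proj v : A (pi z v) = A v.
Proof.
rewrite /xi_proj (is_linB nabla_reeb_lin) (is_linZ nabla_reeb_lin).
by rewrite nabla_reeb_reeb scaler0 subr0.
Qed.

Lemma lambda_nabla_reeb v : l z (A v) = 0.
Proof.
have := tc_reeb_xi Hnab (xi_section_xi_proj v) Uz.
by rewrite -[nabla _ _ _ _]/(A (pi z v)) nabla_reeb_xi_proj.
Qed.

Lemma ctJ_nabla_reeb_ctJ v : J z (A (J z v)) = A v.
Proof.
have := tc_dbar_reeb Hnab (xi_section_xi_proj v) Uz.
rewrite -[nabla _ (fun z => pi z v) _ _]/(A (pi z v)) nabla_reeb_xi_proj.
rewrite -[nabla _ _ _ _]/(A (J z (pi z v))) (ctJ_xi_proj Uz) => /eqP.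
by rewrite subr_eq0 => /eqP.
Qed.

Lemma nabla_reeb_ctJ v : A (J z v) = - J z (A v).
Proof.
by rewrite -[in RHS]ctJ_nabla_reeb_ctJ (ctJ_sqr Uz (lambda_nabla_reeb _)) opprK.
Qed.

Lemma nab_reebl v : G z (X z) v = G z v (X z).
Proof.
have := tc_torsion_reeb Hnab (smooth_on_cst v) Uz.
by rewrite torsionE => /eqP; rewrite subr_eq0 => /eqP.
Qed.

Lemma nab_ctJ_xi v : l z v = 0 -> pi z (G z (J z v) v) = pi z (G z v (J z v)).
Proof.
move=> lv; have := tc_torsion_xi Hnab (xi_section_xi_proj v) Uz.
rewrite torsionE /= (ctJ_xi_proj Uz) (xi_proj_xi lv) (is_linB (xi_proj_lin Uz)) => /eqP.
by rewrite subr_eq0 => /eqP.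
Qed.

Lemma lie_ctJ v : l z v = 0 -> lie_endo X J z v = 2%:R *: J z (A v).
Proof.
move=> lv.
have dl u : differentiable (fun y => l y u) z := Ck_diff (Ck_lambda 0 u) Uz.
have dX := Ck_diff (Ck_reeb 0) Uz; have dJ := Ck_diff (Ck_ctJ 0 v) Uz.
have nl : \forall y \near z, is_lin (W := R^o) (l y).
  by apply: (near_open oI Uz) => y; exact: lambda_lin.
pose W := 'D_(X z) (fun y => J y v) z; pose V := 'D_(J z v) X z.
have lW : l z W = - 'D_(X z) (fun y => l y (J z v)) z.
  have [_ H] := differentiable_lin nl dl dJ.
  have := H (X z).
  rewrite (eq_on_derive (X z) oI Uz (g := cst 0)) => [|y Uy]; last exact: lambda_ctJ.
  by rewrite derive_cst => /esym/eqP; rewrite addrC addr_eq0 => /eqP.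
have lV : l z V = - 'D_(J z v) (fun y => l y (X z)) z.
  have [_ H] := differentiable_lin nl dl dX.
  have := H (J z v).
  rewrite (eq_on_derive (J z v) oI Uz (g := cst (1 : R^o))) => [|y Uy]; last exact: lambda_reeb.
  by rewrite derive_cst => /esym/eqP; rewrite addrC addr_eq0 => /eqP.
have lWV : l z (W - V) = 0.
  rewrite (is_linB (lambda_lin Uz)) lW lV.
  have := dlambda_reeb C (J z v) Uz; rewrite /ext_d => H.
  by rewrite opprK addrC; apply/eqP; rewrite subr_eq0 eq_sym -subr_eq0; apply/eqP.
have piW : pi z W = J z (G z (X z) v) - pi z (G z (X z) (J z v)).
  by rewrite -(hermitian_ctJ (X z) Uz lv) (is_linD (xi_proj_lin Uz)) addrK.
have piV : pi z V = A (J z v) - pi z (G z (X z) (J z v)).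
  rewrite -{1}(xi_proj_xi (lambda_nabla_reeb (J z v))) /nabla_reeb.
  by rewrite (is_linD (xi_proj_lin Uz)) nab_reebl addrK.
have -> : lie_endo X J z v = (W - V) + J z ('D_v X z).
  by rewrite /lie_endo /lie_bracket derive_cst sub0r (is_linN (ctJ_lin Uz)) opprK.
rewrite -(xi_proj_xi lWV) (is_linB (xi_proj_lin Uz)) piW piV nabla_reeb_ctJ nab_reebl.
have -> : 'D_v X z = A v - G z v (X z) by rewrite /nabla_reeb addrK.
rewrite (is_linB (ctJ_lin Uz)).
set p := J z _; set q := pi z _; set r := J z _; clearbody p q r.
by rewrite scaler_nat; row_ring.
Qed.

End NablaReeb.
End ContactPointwise.

Arguments nabla_reeb {R n M} C nab b z v.

(** * The pull-back connection *)

Section PullBack.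
Context {R : realType} {n : nat} {M : manifold R n.*2.+1}.
Context {C : contact_triad M} {nab : connection M} (Hnab : triad_connection C nab).
Context {S : riemann_surface R} {w : S -> M} (Hw : contact_CR_map C w).
Context {a : chart S} {b : chart M}.
Local Notation P := 'rV[R]_2.
Local Notation E := 'rV[R]_(n.*2.+1).
Local Notation U := (rep_dom w a b).
Local Notation c := (rep w a b).
Local Notation j := (rs_j S a).
Local Notation l y := (lambda C b (c y)).
Local Notation J y := (ctJ C b (c y)).
Local Notation G y := (nab b (c y)).
Local Notation pi y := (xi_proj C b (c y)).
Local Notation g y := (g_xi C b (c y)).
Local Notation nb u := (nabla_pi C nab w a b (cst u)).
Local Notation beta := (d_pi C w a b).

Lemma rep_dom_open : open U.
Proof.
rewrite openE => x [ax bx]; rewrite /interior.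
have H1 : nbhs x (chart_img a) by apply: open_nbhs_nbhs; split=> //; exact: chart_img_open.
have H2 : nbhs (w (chart_inv a x)) (chart_dom b).
  by apply: open_nbhs_nbhs; split=> //; exact: chart_dom_open.
have [[cw _] _] := Hw.
have H3 : nbhs x [set y | chart_dom b (w (chart_inv a y))].
  exact: (chart_inv_continuous ax (cw _ _ H2)).
by apply: filterS2 H1 H3 => y.
Qed.

Let oU := rep_dom_open.

Lemma rep_dom_img y : U y -> chart_img a y.
Proof. by case. Qed.

Lemma rep_img y : U y -> chart_img b (c y).
Proof. by case=> _; exact: chart_map_img. Qed.

Lemma Ck_rep k : Ck k U c.
Proof. by apply: smooth_on_Ck; have [[_ H] _] := Hw; exact: H. Qed.

Lemma Ck_pull k (W : normedModType R) (f : E -> W) : Ck k (chart_img b) f -> Ck k U (fun y => f (c y)).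
Proof. by move=> Cf; apply: Ck_comp Cf => //; [exact: rep_img|exact: Ck_rep]. Qed.

Lemma Ck_xi_proj_field k s : Ck k U s -> Ck k U (fun y => pi y (s y)).
Proof.
move=> Cs; apply: (Ck_lin (F := fun y v => pi y v)) => //.
- by move=> y Uy; exact: xi_proj_lin (rep_img Uy).
- by move=> v; exact: (Ck_pull (Ck_xi_proj b k v)).
Qed.

Lemma Ck_g_field k s t : Ck k U s -> Ck k U t -> Ck k U (fun y => g y (s y) (t y)).
Proof.
move=> Cs Ct; apply: (Ck_lin (F := fun y v => g y (s y) v)) => //.
  by move=> y Uy; exact: (g_xi_bilin (rep_img Uy)).1.
move=> v; apply: (Ck_lin (F := fun y u => g y u v)) => //.
  by move=> y Uy; exact: (g_xi_bilin (rep_img Uy)).2.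
by move=> u; exact: (Ck_pull (Ck_g_xi b k u v)).
Qed.

Lemma Ck_d_pi k v : Ck k U (fun y => beta y v).
Proof. by apply: Ck_xi_proj_field; exact: Ck_derive (Ck_rep k.+1). Qed.

Lemma Ck_nabla_pi k u s : Ck k.+1 U s -> Ck k U (nb u s).
Proof.
move=> Cs; apply: (@Ck_xi_proj_field k (fun y => 'D_u s y + G y ('D_u c y) (s y))).
apply: CkD => //; first exact: Ck_derive.
apply: (Ck_lin (F := fun y v => G y ('D_u c y) v)) => //; last exact: CkS.
  by move=> y Uy; exact: (nab_bilin (rep_img Uy)).1.
move=> v; apply: (Ck_lin (F := fun y t => G y t v)) => //.
- by move=> y Uy; exact: (nab_bilin (rep_img Uy)).2.
- by move=> t; exact: (Ck_pull (Ck_nab b k t v)).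
- exact: Ck_derive (Ck_rep k.+1).
Qed.

Lemma lambda_nabla_pi u s y : U y -> l y (nb u s y) = 0.
Proof. by move=> Uy; exact: lambda_xi_proj (rep_img Uy) _. Qed.

Lemma lambda_d_pi y v : U y -> l y (beta y v) = 0.
Proof. by move=> Uy; exact: lambda_xi_proj (rep_img Uy) _. Qed.

Lemma eq_nabla_pi u s t y : U y -> (forall x, U x -> s x = t x) -> nb u s y = nb u t y.
Proof.
move=> Uy st; have E := eq_on_derive u oU Uy st.
by rewrite /nabla_pi /= E (st _ Uy).
Qed.

Lemma nabla_pi_scale u (k : P -> R) s y : U y -> differentiable k y -> differentiable s y ->
  nb u (fun x => k x *: s x) y = k y *: nb u s y + 'D_u k y *: pi y (s y).
Proof.
move=> Uy dk ds; rewrite /nabla_pi /=.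
have [_ ->] := differentiable_scale dk ds.
have lp := xi_proj_lin (C := C) (rep_img Uy); have lG := (nab_bilin (nab := nab) (rep_img Uy)).1.
by rewrite (is_linZ (lG _)) addrAC -scalerDr lp (is_linZ lp).
Qed.

Lemma nabla_piB u s t y : U y -> differentiable s y -> differentiable t y ->
  nb u (fun x => s x - t x) y = nb u s y - nb u t y.
Proof.
move=> Uy ds dt; have Iy := rep_img Uy.
have E : 'D_u (fun x => s x - t x) y = 'D_u s y - 'D_u t y.
  by apply: (@deriveB _ _ _ s t); exact: diff_derivable.
rewrite /nabla_pi /= E (is_linB ((nab_bilin Iy).1 _)) addrACA -opprD.
by rewrite (is_linB (xi_proj_lin Iy)).
Qed.

Lemma nabla_pi_linl s y : U y -> differentiable s y -> is_lin (fun u => nb u s y).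
Proof.
move=> Uy ds k u v; rewrite /nabla_pi /= -(xi_proj_lin (rep_img Uy)).
rewrite (is_lin_derive ds) (is_lin_derive (Ck_diff (Ck_rep 0) Uy)).
by rewrite ((nab_bilin (rep_img Uy)).2 (s y)) scaleDD.
Qed.

Lemma nabla_pi_linr u (F : P -> P -> E) y : U y -> (forall x, U x -> is_lin (F x)) ->
  (forall v, differentiable (F^~ v) y) -> is_lin (fun v => nb u (F^~ v) y).
Proof.
move=> Uy lF dF k v v'; rewrite /nabla_pi /= -(xi_proj_lin (rep_img Uy)).
rewrite (is_lin_derive_param u oU Uy lF dF) (lF _ Uy) ((nab_bilin (rep_img Uy)).1 _).
by rewrite scaleDD.
Qed.

Lemma nabla_pi_field u (F : P -> P -> E) (V : P -> P) y : U y ->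
  (forall x, U x -> is_lin (F x)) -> (forall v, differentiable (F^~ v) y) ->
  (forall v, l y (F y v) = 0) -> differentiable V y ->
  nb u (fun x => F x (V x)) y = nb u (F^~ (V y)) y + F y ('D_u V y).
Proof.
move=> Uy lF dF xF dV; rewrite /nabla_pi /=.
have [||//|_ ->] := @differentiable_lin R P E 2 F V y.
- exact: (near_open oU Uy).
- exact: dF.
rewrite -addrA [F y _ + _]addrC addrA (is_linD (xi_proj_lin (rep_img Uy))).
by rewrite (xi_proj_xi (xF _)).
Qed.

Lemma g_xi_parallel u s t y : U y -> differentiable s y -> differentiable t y ->
  (forall x, U x -> l x (s x) = 0) -> (forall x, U x -> l x (t x) = 0) ->
  'D_u (fun x => g x (s x) (t x)) y = g y (nb u s y) (t y) + g y (s y) (nb u t y).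
Proof.
move=> Uy ds dt xs xt; have Iy := rep_img Uy.
pose T x := triad_metric C b (c x).
have CT p q : Ck 0 U (fun x => T x p q) := Ck_pull (Ck_triad_metric b 0 p q).
have lT x : U x -> is_bilin (W := R^o) (T x).
  by move=> Ux; exact: triad_metric_bilin (rep_img Ux).
have [d1 E1] : differentiable (fun x => T x (s y) (t x)) y /\
   forall u, 'D_u (fun x => T x (s y) (t x)) y =
     'D_u (fun x => T x (s y) (t y)) y + T y (s y) ('D_u t y).
  apply: (@differentiable_lin R P R^o _ (fun x v => T x (s y) v)) => //.
  - by apply: (near_open oU Uy) => x Ux; exact: (lT x Ux).1.
  - by move=> v; exact: (Ck_diff (CT _ _) Uy).
have [d2 E2] : differentiable (fun x => T x (s x) (t x)) y /\
   forall u, 'D_u (fun x => T x (s x) (t x)) y =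
     'D_u (fun x => T x (s y) (t x)) y + T y ('D_u s y) (t y).
  apply: (@differentiable_lin R P R^o _ (fun x v => T x v (t x))) => //.
  - by apply: (near_open oU Uy) => x Ux; exact: (lT x Ux).2.
  - move=> v.
    have [] // := @differentiable_lin R P R^o _ (fun x t => T x v t) t y.
    + by apply: (near_open oU Uy) => x Ux; exact: (lT x Ux).1.
    + by move=> v'; exact: (Ck_diff (CT _ _) Uy).
have E3 : 'D_u (fun x => T x (s y) (t y)) y =
  T y (G y ('D_u c y) (s y)) (t y) + T y (s y) (G y ('D_u c y) (t y)).
  rewrite -(triad_metric_parallel Hnab ('D_u c y) (s y) (t y) Iy).
  apply: (derive_comp u (f := fun z => triad_metric C b z (s y) (t y)) (Ck_diff (Ck_rep 0) Uy)).
  exact: (Ck_diff (Ck_triad_metric b 0 _ _) Iy).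
transitivity ('D_u (fun x => T x (s x) (t x)) y).
  apply: (eq_on_derive u oU Uy) => x Ux.
  by rewrite /T (triad_metric_xil _ (rep_img Ux) (xt _ Ux)) (xi_proj_xi (xs _ Ux)).
rewrite E2 E1 E3 /nabla_pi /= -(triad_metric_xil _ Iy (xt _ Uy)) -(triad_metric_xir _ Iy (xs _ Uy)).
have lt := triad_metric_bilin (C := C) Iy; rewrite /T.
rewrite (is_linD (lt.1 _)) (is_linD (lt.2 _)).
set p := triad_metric _ _ _ _ _; set q := triad_metric _ _ _ _ _.
set r := triad_metric _ _ _ _ _; set o := triad_metric _ _ _ _ _; clearbody p q r o.
ring.
Qed.

Lemma ctJ_parallel u s y : U y -> differentiable s y ->
  (forall x, U x -> l x (s x) = 0) ->
  nb u (fun x => J x (s x)) y = J y (nb u s y).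
Proof.
move=> Uy ds xs; have Iy := rep_img Uy.
have [||//|_ E1] := @differentiable_lin R P E _ (fun x v => J x v) s y.
- by apply: (near_open oU Uy) => x Ux; exact: ctJ_lin (rep_img Ux).
- by move=> v; exact: (Ck_diff (Ck_pull (Ck_ctJ b 0 v)) Uy).
rewrite /nabla_pi /= E1 (ctJ_xi_proj Iy) (is_linD (ctJ_lin Iy)).
rewrite (derive_comp u (f := fun z => ctJ C b z (s y)) (Ck_diff (Ck_rep 0) Uy)
  (Ck_diff (Ck_ctJ b 0 _) Iy)).
rewrite addrAC (is_linD (xi_proj_lin Iy)) (hermitian_ctJ Hnab _ Iy (xs _ Uy)).
by rewrite (xi_proj_xi (lambda_ctJ Iy _)) addrC.
Qed.

Lemma d_pi_lin y : U y -> is_lin (beta y).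
Proof.
move=> Uy k u v; rewrite /d_pi (is_lin_derive (Ck_diff (Ck_rep 0) Uy)).
by rewrite (xi_proj_lin (rep_img Uy)).
Qed.

Lemma ctJ_d_pi y v : U y -> J y (beta y v) = beta y (j y v).
Proof.
move=> Uy; have [_ H] := Hw; have Iy := rep_img Uy.
have := H a b y v Uy; rewrite /dbar_pi => /eqP; rewrite scaler_eq0 invr_eq0 pnatr_eq0 /=.
rewrite addr_eq0 => /eqP ->.
by rewrite (is_linN (ctJ_lin Iy)) ctJ_sqr// ?opprK//; exact: lambda_d_pi.
Qed.

Lemma del_piE y v : U y -> del_pi C w a b y v = beta y v.
Proof.
move=> Uy; have jl := rs_j_sqr v (rep_dom_img Uy).
rewrite /del_pi (ctJ_d_pi _ Uy) jl (is_linN (d_pi_lin Uy)) opprK.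
by set B := d_pi _ _ _ _ _ _; clearbody B; apply/rowP => i; rewrite !mxE; field.
Qed.

(* The exterior covariant derivative of [beta] on constant fields. *)
Definition torsion_pi y u v : E := nb u (beta^~ v) y - nb v (beta^~ u) y.

Lemma torsion_pi_alternating y u : torsion_pi y u u = 0.
Proof. exact: subrr. Qed.

Lemma torsion_pi_bilin y : U y -> is_bilin (torsion_pi y).
Proof.
move=> Uy.
have db v := Ck_diff (Ck_d_pi 0 v) Uy.
have H u : is_lin (fun v => nb u (beta^~ v) y).
  by apply: nabla_pi_linr => //; exact: d_pi_lin.
have H' v : is_lin (fun u => nb u (beta^~ v) y) by exact: nabla_pi_linl.
split=> [u|v] k x z.
  exact: etrans (congr2 (fun p q => p - q) (H u k x z) (H' u k x z)) (scaleDB _ _ _ _ _).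
exact: etrans (congr2 (fun p q => p - q) (H' v k x z) (H v k x z)) (scaleDB _ _ _ _ _).
Qed.

End PullBack.

Arguments torsion_pi {R n M} C nab {S} w a b y u v.

(** * The torsion of the pull-back connection *)

Section PullBackTorsion.
Context {R : realType} {n : nat} {M : manifold R n.*2.+1}.
Context {C : contact_triad M} {nab : connection M} (Hnab : triad_connection C nab).
Context {S : riemann_surface R} (h : kahler_metric S).
Context {w : S -> M} (Hw : contact_CR_map C w).
Context {a : chart S} {b : chart M}.
Local Notation P := 'rV[R]_2.
Local Notation E := 'rV[R]_(n.*2.+1).
Local Notation U := (rep_dom w a b).
Local Notation c := (rep w a b).
Local Notation j := (rs_j S a).
Local Notation l y := (lambda C b (c y)).
Local Notation J y := (ctJ C b (c y)).
Local Notation G y := (nab b (c y)).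
Local Notation A y := (nabla_reeb C nab b (c y)).
Local Notation pi y := (xi_proj C b (c y)).
Local Notation nb u := (nabla_pi C nab w a b (cst u)).
Local Notation beta := (d_pi C w a b).

Let oU : open U := rep_dom_open Hw.

Lemma nabla_d_pi y u v : U y -> nb u (beta^~ v) y =
  pi y ('D_u ('D_v c) y + G y ('D_u c y) ('D_v c y)) - l y ('D_v c y) *: A y (beta y u).
Proof.
move=> Uy; have Iy := rep_img Uy.
have dc := Ck_diff (Ck_rep Hw 0) Uy.
have dDc : differentiable ('D_v c) y := Ck_diff (Ck_derive v (Ck_rep Hw 1)) Uy.
have dX : differentiable (fun x => reeb C b (c x)) y.
  exact: (Ck_diff (Ck_pull Hw (Ck_reeb b 0)) Uy).
have dl : differentiable (fun x => l x ('D_v c x)) y.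
  have [] // := @differentiable_lin R P R^o _ (fun x t => l x t) ('D_v c) y.
  - by apply: (near_open oU Uy) => x Ux; exact: lambda_lin (rep_img Ux).
  - by move=> t; exact: (Ck_diff (Ck_pull Hw (Ck_lambda b 0 t)) Uy).
have [dlX ElX] := differentiable_scale dl dX.
pose k := 'D_u (fun x => l x ('D_v c x)) y.
have EX : 'D_u (fun x => reeb C b (c x)) y = 'D_('D_u c y) (reeb C b) (c y).
  exact: (derive_comp u dc (Ck_diff (Ck_reeb b 0) Iy)).
have E1 : 'D_u (beta^~ v) y = 'D_u ('D_v c) y -
    (l y ('D_v c y) *: 'D_('D_u c y) (reeb C b) (c y) + k *: reeb C b (c y)).
  transitivity ('D_u ('D_v c) y - 'D_u (fun x => l x ('D_v c x) *: reeb C b (c x)) y).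
    apply: (@deriveB _ _ _ ('D_v c) (fun x => l x ('D_v c x) *: reeb C b (c x))).
    - exact: diff_derivable.
    - exact: diff_derivable.
  by rewrite ElX EX.
have [Gr _] := nab_bilin (nab := nab) Iy; have lp := xi_proj_lin (C := C) Iy.
have E2 : A y (beta y u) = pi y (A y ('D_u c y)).
  rewrite [beta y u]/(xi_proj _ _ _ _) (nabla_reeb_xi_proj Hnab Iy).
  by rewrite (xi_proj_xi (lambda_nabla_reeb Hnab Iy _)).
have E3 : G y ('D_u c y) (beta y v) =
    G y ('D_u c y) ('D_v c y) - l y ('D_v c y) *: G y ('D_u c y) (reeb C b (c y)).
  by rewrite [beta y v]/(xi_proj _ _ _ _) /xi_proj (is_linB (Gr _)) (is_linZ (Gr _)).
rewrite /nabla_pi /= E1 E3 E2 /nabla_reeb !(is_linD lp, is_linN lp, is_linZ lp).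
rewrite (xi_proj_reeb (C := C) Iy) scaler0 addr0.
set p1 := pi y _; set p2 := pi y _; set p3 := pi y _; set p4 := pi y _; set s := l y _.
clearbody p1 p2 p3 p4 s; row_ring.
Qed.

Lemma subrBB (V : zmodType) (x y z : V) : x - y - (x - z) = z - y.
Proof. by rewrite opprB addrC addrA subrK. Qed.

Lemma torsion_pi_j y u : U y -> torsion_pi C nab w a b y u (j y u) =
  l y ('D_u c y) *: A y (beta y (j y u)) - l y ('D_(j y u) c y) *: A y (beta y u).
Proof.
move=> Uy; have Iy := rep_img Uy; rewrite /torsion_pi.
have := nab_ctJ_xi Hnab Iy (lambda_d_pi (C := C) u Uy); rewrite (ctJ_d_pi Hw u Uy) => /esym T0.
move: (j y u) T0 => v T0.
rewrite (nabla_d_pi u v Uy) (nabla_d_pi v u Uy).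
have EE : 'D_u ('D_v c) y = 'D_v ('D_u c) y := derive_commute_rV u v oU Uy (Ck_rep Hw 1).
have [Gr Gl] := nab_bilin (nab := nab) Iy; have lp := xi_proj_lin (C := C) Iy.
have bE t : 'D_t c y = beta y t + l y ('D_t c y) *: reeb C b (c y).
  by rewrite /d_pi /xi_proj subrK.
have Tg bu bv k1 k2 : pi y (G y bu bv) = pi y (G y bv bu) ->
    pi y (G y (bu + k1 *: reeb C b (c y)) (bv + k2 *: reeb C b (c y))) =
    pi y (G y (bv + k2 *: reeb C b (c y)) (bu + k1 *: reeb C b (c y))).
  move=> T1; rewrite !(is_linD (Gr _)) !(is_linD (Gl _)) !(is_linZ (Gr _)) !(is_linZ (Gl _)).
  rewrite !(nab_reebl Hnab Iy) !(is_linD lp) !(is_linZ lp) T1.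
  set p1 := pi y _; set p2 := pi y _; set p3 := pi y _; set p4 := pi y _.
  by clearbody p1 p2 p3 p4; row_ring.
have T : pi y (G y ('D_u c y) ('D_v c y)) = pi y (G y ('D_v c y) ('D_u c y)).
  by rewrite (bE u) (bE v); exact: Tg.
have K : pi y ('D_u ('D_v c) y + G y ('D_u c y) ('D_v c y)) =
         pi y ('D_v ('D_u c) y + G y ('D_v c y) ('D_u c y)).
  exact: etrans (is_linD lp _ _) (etrans (congr2 (fun p q => p + q) (congr1 (pi y) EE) T)
    (esym (is_linD lp _ _))).
have key (p q s t : E) : p = q -> p - s - (q - t) = t - s by move=> ->; exact: subrBB.
exact: key K.
Qed.

Lemma wedge_torsion_pi y u v : U y ->
  wedge (pull_lambda_j C w a b) (LJ_del_pi C w a b) y u v =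
  - (2%:R *: torsion_pi C nab w a b y u v).
Proof.
move=> Uy; have Iy := rep_img Uy; have Ay := rep_dom_img Uy.
have LJ t : LJ_del_pi C w a b y t = 2%:R *: J y (A y (beta y t)).
  rewrite /LJ_del_pi (del_piE Hw _ Uy) (lie_ctJ Hnab Iy)//.
  exact: lambda_d_pi.
have lLJ : is_lin (LJ_del_pi C w a b y).
  move=> k p q; rewrite !LJ (d_pi_lin Hw Uy) (nabla_reeb_lin Iy) (ctJ_lin Iy) scalerDr.
  by rewrite !scalerA mulrC.
have lpl : is_lin (W := R^o) (pull_lambda_j C w a b y).
  move=> k p q; rewrite /pull_lambda_j (j_lin Ay).
  rewrite (is_lin_derive (Ck_diff (Ck_rep Hw 0) Uy)).
  exact: lambda_lin.
apply: (alternating_eq (j := j y) (h_bilin (h := h) Ay) (h_sym Ay) (h_pos Ay) (j_lin Ay) (jj Ay) (h_j Ay)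
  (B := wedge (pull_lambda_j C w a b) (LJ_del_pi C w a b) y)
  (B' := fun u v => - (2%:R *: torsion_pi C nab w a b y u v))).
- split=> [p|q] k x z; rewrite /wedge lLJ lpl -?[_ *: _ : R^o]/(_ * _).
    set p1 := LJ_del_pi _ _ _ _ _ _; set p2 := LJ_del_pi _ _ _ _ _ _; set p3 := LJ_del_pi _ _ _ _ _ _.
    set s1 := pull_lambda_j _ _ _ _ _ _; set s2 := pull_lambda_j _ _ _ _ _ _; set s3 := pull_lambda_j _ _ _ _ _ _.
    by clearbody p1 p2 p3 s1 s2 s3; row_ring.
  set p1 := LJ_del_pi _ _ _ _ _ _; set p2 := LJ_del_pi _ _ _ _ _ _; set p3 := LJ_del_pi _ _ _ _ _ _.
  set s1 := pull_lambda_j _ _ _ _ _ _; set s2 := pull_lambda_j _ _ _ _ _ _; set s3 := pull_lambda_j _ _ _ _ _ _.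
  by clearbody p1 p2 p3 s1 s2 s3; row_ring.
- have [t1 t2] := torsion_pi_bilin (nab := nab) Hw Uy.
  have L (k : R) (s t : E) : - (2%:R *: (k *: s + t)) = k *: - (2%:R *: s) + - (2%:R *: t).
    by row_ring.
  split=> [p|q] k x z; first by rewrite (t1 p); exact: L.
  by rewrite (t2 q); exact: L.
- by move=> p; exact: subrr.
- by move=> p; rewrite torsion_pi_alternating scaler0 oppr0.
- move=> p; rewrite (torsion_pi_j p Uy) /wedge !LJ /pull_lambda_j (jj Ay).
  rewrite -!(ctJ_d_pi Hw _ Uy) (ctJ_nabla_reeb_ctJ Hnab Iy) (nabla_reeb_ctJ Hnab Iy).
  rewrite (is_linN (is_lin_derive (Ck_diff (Ck_rep Hw 0) Uy))) (is_linN (lambda_lin Iy)).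
  set p1 := A y _; set p2 := J y _; set s1 := l y _; set s2 := l y _.
  by clearbody p1 p2 s1 s2; row_ring.
Qed.
End PullBackTorsion.

(** * Bochner-Weitzenboeck formula *)

Section Weitzenboeck.
Context {R : realType} {n : nat} {M : manifold R n.*2.+1}.
Context {C : contact_triad M} {nab : connection M} (Hnab : triad_connection C nab).
Context {S : riemann_surface R} {h : kahler_metric S}.
Context {D : connection S} (HD : levi_civita h D).
Context {w : S -> M} (Hw : contact_CR_map C w).
Context {a : chart S} {b : chart M}.
Local Notation P := 'rV[R]_2.
Local Notation E := 'rV[R]_(n.*2.+1).
Local Notation d_ i := (delta_mx 0 i : P).
Local Notation U := (rep_dom w a b).
Local Notation c := (rep w a b).
Local Notation j := (rs_j S a).
Local Notation l y := (lambda C b (c y)).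
Local Notation J y := (ctJ C b (c y)).
Local Notation g y := (g_xi C b (c y)).
Local Notation nb u := (nabla_pi C nab w a b (cst u)).
Local Notation beta := (d_pi C w a b).
Local Notation tor := (torsion_pi C nab w a b).

Let oU : open U := rep_dom_open Hw.

Definition nabla_beta (y u v : P) : E := nb u (beta^~ v) y - beta y (D a y u v).

(* [torsion_pi] is [area_form] times this section. *)
Definition torsion_density (y : P) : E :=
  (h a y (j y (d_ 0)) (d_ 1))^-1 *: tor y (d_ 0) (d_ 1).

Definition nabla2_beta (y z u v : P) : E :=
  nb z (fun x => nabla_beta x u v) y - nabla_beta y u (D a y z v)
  - nabla_beta y (D a y z u) v.

Local Notation N := nabla_beta.
Local Notation NN := nabla2_beta.
Local Notation sg := torsion_density.

Lemma diff_d_pi y v : U y -> differentiable (beta^~ v) y.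
Proof. by move=> Uy; exact: (Ck_diff (Ck_d_pi Hw 0 v) Uy). Qed.

Lemma Ck_nabla_d_pi k u v : Ck k U (nb u (beta^~ v)).
Proof. exact: (Ck_nabla_pi Hw u (Ck_d_pi Hw k.+1 v)). Qed.

Lemma nabla_d_pi_bilin y : U y -> is_bilin (fun u v => nb u (beta^~ v) y).
Proof.
move=> Uy; split=> [u|v].
  exact: (nabla_pi_linr Hw u (F := beta) Uy (fun x => @d_pi_lin _ _ _ _ _ _ Hw _ _ x)
    (fun v => diff_d_pi v Uy)).
exact: (nabla_pi_linl Hw (s := beta^~ v) Uy (diff_d_pi v Uy)).
Qed.

Lemma nabla_beta_bilin y : U y -> is_bilin (N y).
Proof.
move=> Uy; have [n1 n2] := nabla_d_pi_bilin Uy; have lb := d_pi_lin Hw Uy.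
have Ay := rep_dom_img Uy.
split=> [u|v] k p q.
  exact: etrans (congr2 (fun s t => s - t) (n1 u k p q)
    (etrans (congr1 (beta y) (D_linr (D := D) Ay u k p q)) (lb _ _ _))) (scaleDB _ _ _ _ _).
exact: etrans (congr2 (fun s t => s - t) (n2 v k p q)
    (etrans (congr1 (beta y) (D_linl (D := D) Ay v k p q)) (lb _ _ _))) (scaleDB _ _ _ _ _).
Qed.

Lemma Ck_nabla_beta k u v : Ck k U (fun y => N y u v).
Proof.
apply: (CkB oU); first exact: Ck_nabla_d_pi.
apply: (Ck_lin (F := beta)) => //.
- by move=> y Uy; exact: d_pi_lin.
- by move=> t; exact: Ck_d_pi.
- by apply: (Ck_sub (U' := chart_img a)); [exact: rep_dom_img|exact: Ck_D].
Qed.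

Lemma diff_nabla_beta y u v : U y -> differentiable (fun y => N y u v) y.
Proof. by move=> Uy; exact: (Ck_diff (Ck_nabla_beta 0 u v) Uy). Qed.

Lemma lambda_nabla_beta y u v : U y -> l y (N y u v) = 0.
Proof.
move=> Uy; rewrite /nabla_beta (is_linB (lambda_lin (rep_img Uy))).
by rewrite lambda_nabla_pi// lambda_d_pi// subrr.
Qed.

Lemma nabla_d_piE y u v : nb u (beta^~ v) y = N y u v + beta y (D a y u v).
Proof. by rewrite /nabla_beta subrK. Qed.

Lemma derive_j y z u : U y -> 'D_z (fun x => j x u) y = j y (D a y z u) - D a y z (j y u).
Proof. by move=> Uy; exact: (j_parallel HD z u (rep_dom_img Uy)). Qed.

Lemma diff_j y u : U y -> differentiable (fun x => j x u) y.
Proof. by move=> Uy; exact: (Ck_diff (Ck_j a 0 u) (rep_dom_img Uy)). Qed.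

Lemma nabla_beta_j y z u : U y -> N y z (j y u) = J y (N y z u).
Proof.
move=> Uy; have lb := d_pi_lin Hw Uy.
have E1 : nb z (fun x => beta x (j x u)) y =
    nb z (beta^~ (j y u)) y + beta y (j y (D a y z u) - D a y z (j y u)).
  rewrite -(derive_j z u Uy).
  apply: (nabla_pi_field Hw z (F := beta) (V := fun x => j x u) Uy).
  - by move=> x Ux; exact: d_pi_lin.
  - by move=> v; exact: diff_d_pi.
  - by move=> v; exact: lambda_d_pi.
  - exact: diff_j.
have E2 : nb z (fun x => beta x (j x u)) y = J y (nb z (beta^~ u) y).
  rewrite -(ctJ_parallel Hnab Hw z Uy (diff_d_pi u Uy)); last first.
    by move=> x Ux; exact: lambda_d_pi.
  by apply: (eq_nabla_pi Hw z Uy) => x Ux; rewrite (ctJ_d_pi Hw).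
have E3 : beta y (j y (D a y z u) - D a y z (j y u)) =
    J y (beta y (D a y z u)) - beta y (D a y z (j y u)).
  by rewrite (ctJ_d_pi Hw _ Uy); exact: (is_linB lb).
have key (p q r s : E) : p + (r - s) = q -> p - s = q - r.
  by move=> <-; rewrite addrA addrAC addrK.
exact: etrans (key _ _ _ _ (etrans (congr1 (fun t => _ + t) (esym E3)) (etrans (esym E1) E2)))
  (esym (is_linB (ctJ_lin (rep_img Uy)) _ _)).
Qed.

Lemma nabla_beta_swap y u v : U y -> N y u v - N y v u = tor y u v.
Proof.
move=> Uy; rewrite /nabla_beta /torsion_pi (D_sym HD (rep_dom_img Uy) v u).
have key (p q s : E) : p - s - (q - s) = p - q by rewrite opprB addrA subrK.
exact: key.
Qed.

Lemma torsion_density_area y u v : U y -> tor y u v = h a y (j y u) v *: sg y.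
Proof.
move=> Uy; have Ay := rep_dom_img Uy.
apply: (alternating_area (h_bilin (h := h) Ay) (h_sym Ay) (h_pos Ay) (j_lin Ay) (jj Ay) (h_j Ay)).
  exact: torsion_pi_bilin.
by move=> t; exact: torsion_pi_alternating.
Qed.

Lemma Ck_area k u v : Ck k U (fun y => h a y (j y u) v).
Proof.
apply: (Ck_sub (U' := chart_img a)); first exact: rep_dom_img.
apply: (Ck_lin (W := R^o) (F := fun y t => h a y t v)).
- exact: chart_img_open.
- by move=> y Uy; exact: (h_bilin Uy).2.
- by move=> t; exact: Ck_h.
- exact: Ck_j.
Qed.

Lemma Ck_torsion_density k : Ck k U sg.
Proof.
apply: (Ck_scale oU).
  apply: (Ck_inv oU); last exact: Ck_area.
  move=> y Uy; have Ay := rep_dom_img Uy.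
  exact: (area_neq0 (h_bilin (h := h) Ay) (h_sym Ay) (h_pos Ay) (j_lin Ay) (jj Ay) (h_j Ay)).
exact: (CkB oU (Ck_nabla_d_pi k _ _) (Ck_nabla_d_pi k _ _)).
Qed.

Lemma lambda_torsion_density y : U y -> l y (sg y) = 0.
Proof.
move=> Uy; have ll := lambda_lin (C := C) (rep_img Uy).
have e u v : l y (nb u (beta^~ v) y) = 0 := lambda_nabla_pi u _ Uy.
have t0 : l y (tor y (d_ 0) (d_ 1)) = 0.
  exact: etrans (is_linB ll _ _) (etrans (congr2 (fun p q => p - q) (e _ _) (e _ _)) (subrr 0)).
by rewrite /torsion_density (is_linZ ll) t0 scaler0.
Qed.

End Weitzenboeck.

Arguments nabla_beta {R n M} C nab {S} D w a b y u v.
Arguments nabla2_beta {R n M} C nab {S} D w a b y z u v.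
Arguments torsion_density {R n M} C nab {S} h w a b y.

Section SecondOrder.
Context {R : realType} {n : nat} {M : manifold R n.*2.+1}.
Context {C : contact_triad M} {nab : connection M} (Hnab : triad_connection C nab).
Context {S : riemann_surface R} {h : kahler_metric S}.
Context {D : connection S} (HD : levi_civita h D).
Context {w : S -> M} (Hw : contact_CR_map C w).
Context {a : chart S} {b : chart M}.
Local Notation P := 'rV[R]_2.
Local Notation E := 'rV[R]_(n.*2.+1).
Local Notation d_ i := (delta_mx 0 i : P).
Local Notation U := (rep_dom w a b).
Local Notation c := (rep w a b).
Local Notation j := (rs_j S a).
Local Notation l y := (lambda C b (c y)).
Local Notation J y := (ctJ C b (c y)).
Local Notation g y := (g_xi C b (c y)).
Local Notation nb u := (nabla_pi C nab w a b (cst u)).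
Local Notation beta := (d_pi C w a b).
Local Notation tor := (torsion_pi C nab w a b).
Local Notation N := (nabla_beta C nab D w a b).
Local Notation NN := (nabla2_beta C nab D w a b).
Local Notation sg := (torsion_density C nab h w a b).
Local Notation f := (energy_pi C h w a b).

Let oU : open U := rep_dom_open Hw.

Lemma form_innerE y (e : 'I_2 -> P) (be ga : P -> E) : U y -> orthonormal_frame h a y e ->
  is_lin be -> is_lin ga ->
  form_inner C h w a b y be ga = \sum_i g y (be (e i)) (ga (e i)).
Proof.
move=> Uy he lb lg; have [gr gl] := g_xi_bilin (C := C) (rep_img Uy).
apply: (frame_trace (h_bilin (h := h) (rep_dom_img Uy)) he
  (B := fun u v => g y (be u) (ga v))).
split=> [u|v] k p q; [rewrite lg|rewrite lb]; [exact: gr|exact: gl].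
Qed.

Lemma g_d_pi y u v : U y -> g y (beta y u) (beta y v) = 2^-1 * f y * h a y u v.
Proof.
move=> Uy; have Ay := rep_dom_img Uy; have [gr gl] := g_xi_bilin (C := C) (rep_img Uy).
have lb := d_pi_lin Hw Uy.
have [e he] := frame_exists (h_bilin (h := h) Ay) (h_sym Ay) (h_pos Ay) (jj Ay) (h_j Ay).
rewrite /energy_pi /form_norm2 (form_innerE Uy he lb lb).
apply: (j_invariant_trace (h_bilin (h := h) Ay) (h_sym Ay) (jj Ay) (h_j Ay) he
  (B := fun u v => g y (beta y u) (beta y v))).
- by split=> [p|p] k q r; rewrite lb; [exact: gr|exact: gl].
- by move=> p q; apply: (g_xi_sym (rep_img Uy)); exact: lambda_d_pi.
- move=> p q; rewrite -!(ctJ_d_pi Hw _ Uy).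
  by apply: (g_xi_ctJ (rep_img Uy)); exact: lambda_d_pi.
Qed.

Lemma Ck_energy k : Ck k U f.
Proof.
have d0n0 : d_ 0 != 0.
  by apply/eqP => /rowP /(_ 0); rewrite !mxE /= => /eqP; rewrite oner_eq0.
have h0 y : U y -> h a y (d_ 0) (d_ 0) != 0.
  by move=> Uy; rewrite gt_eqF//; exact: (h_pos (rep_dom_img Uy)).
have Ch : Ck k U (fun y => (2^-1 * h a y (d_ 0) (d_ 0))^-1).
  apply: (Ck_inv oU) => [y Uy|].
    by apply: mulf_neq0; [rewrite invr_neq0 ?pnatr_eq0|exact: h0].
  apply: (@Ck_scale R P R^o k U (cst 2^-1)) => //; first exact: Ck_cst.
  by apply: (Ck_sub (U' := chart_img a)); [exact: rep_dom_img|exact: Ck_h].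
have Cg : Ck k U (fun y => g y (beta y (d_ 0)) (beta y (d_ 0))).
  exact: (Ck_g_field Hw (Ck_d_pi Hw k (d_ 0)) (Ck_d_pi Hw k (d_ 0))).
have CC : Ck k U (fun y => (2^-1 * h a y (d_ 0) (d_ 0))^-1
    * g y (beta y (d_ 0)) (beta y (d_ 0))).
  exact: (@Ck_scale R P R^o k U _ _ oU Ch Cg).
apply: (Ck_eq oU _ CC) => y Uy; rewrite g_d_pi//.
by have := h0 y Uy; set p := h _ _ _ _; set q := f y; clearbody p q => p0; field.
Qed.

Lemma diff_energy y : U y -> differentiable f y.
Proof. by move=> Uy; exact: (Ck_diff (Ck_energy 0) Uy). Qed.

Lemma diff_h_rep y u v : U y -> differentiable (fun x => h a x u v) y.
Proof. by move=> Uy; exact: (Ck_diff (Ck_h a 0 u v) (rep_dom_img Uy)). Qed.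

Lemma derive_h_rep y z u v : U y ->
  'D_z (fun x => h a x u v) y = h a y (D a y z u) v + h a y u (D a y z v).
Proof. by move=> Uy; exact: (h_parallel HD (rep_dom_img Uy)). Qed.

Lemma energy_derive y z u v : U y ->
  g y (N y z u) (beta y v) + g y (beta y u) (N y z v) = 2^-1 * 'D_z f y * h a y u v.
Proof.
move=> Uy; have [gr gl] := g_xi_bilin (C := C) (rep_img Uy).
have xb v' x : U x -> l x (beta x v') = 0 by move=> Ux; exact: lambda_d_pi.
have E1 := g_xi_parallel Hnab Hw z Uy (diff_d_pi Hw u Uy) (diff_d_pi Hw v Uy) (xb u) (xb v).
have E2 : 'D_z (fun x => g x (beta x u) (beta x v)) y =
    2^-1 * (f y * (h a y (D a y z u) v + h a y u (D a y z v)) + 'D_z f y * h a y u v).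
  transitivity ('D_z (fun x => 2^-1 *: (f x *: (h a x u v : R^o))) y).
    apply: (eq_on_derive z oU Uy) => x Ux.
    by rewrite g_d_pi// -mulrA.
  have [d1 e1] := differentiable_scale (W := R^o) (diff_energy Uy) (diff_h_rep u v Uy).
  rewrite deriveZ; last exact: diff_derivable.
  by rewrite e1 derive_h_rep.
have E3 : g y (nb z (beta^~ u) y) (beta y v) =
    g y (N y z u) (beta y v) + 2^-1 * f y * h a y (D a y z u) v.
  have e1 : nb z (beta^~ u) y = N y z u + beta y (D a y z u) by exact: nabla_d_piE.
  have lin (p q t : E) : g y (p + q) t = g y p t + g y q t := is_linD (gl t) p q.
  transitivity (g y (N y z u + beta y (D a y z u)) (beta y v)).
    exact: (congr1 (fun t => g y t (beta y v)) e1).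
  exact: etrans (lin _ _ _)
    (congr1 (fun t => g y (N y z u) (beta y v) + t) (g_d_pi (D a y z u) v Uy)).
have E4 : g y (beta y u) (nb z (beta^~ v) y) =
    g y (beta y u) (N y z v) + 2^-1 * f y * h a y u (D a y z v).
  have e1 : nb z (beta^~ v) y = N y z v + beta y (D a y z v) by exact: nabla_d_piE.
  have lin (p q t : E) : g y t (p + q) = g y t p + g y t q := is_linD (gr t) p q.
  transitivity (g y (beta y u) (N y z v + beta y (D a y z v))).
    exact: (congr1 (g y (beta y u)) e1).
  exact: etrans (lin _ _ _)
    (congr1 (fun t => g y (beta y u) (N y z v) + t) (g_d_pi u (D a y z v) Uy)).
move: E1; rewrite E2 E3 E4.
set p1 := g y _ _; set p2 := g y _ _; set q1 := h _ _ _ _; set q2 := h _ _ _ _.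
set q3 := h _ _ _ _; set f0 := f y; set f1 := 'D_z _ _.
clearbody p1 p2 q1 q2 q3 f0 f1 => H.
rewrite (_ : p1 + p2 = p1 + 2^-1 * f0 * q1 + (p2 + 2^-1 * f0 * q2) - 2^-1 * f0 * (q1 + q2));
  last by ring.
by rewrite -H; ring.
Qed.

Lemma energy_hess_algebra (p1 p2 p3 p4 p5 p6 h1 h2 h3 f1 f2 f3 : R) :
  4^-1 * (f1 * (h1 + h2) + f2 * h3) = p1 + p3 + p6 + (p2 + p5) ->
  p3 + p4 = 2^-1 * f1 * h1 -> p6 = 4^-1 * f3 * h3 -> p4 = p5 -> h2 = h1 ->
  2%:R * p1 + 2%:R * p2 = 2^-1 * (f2 - f3) * h3.
Proof.
move=> H1 H2 H3 H4 H5.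
have -> : 2%:R * p1 + 2%:R * p2 =
  2%:R * ((p1 + p3 + p6 + (p2 + p5)) - (p3 + p4) - p6) by rewrite H4; ring.
by rewrite -H1 H2 H5 H3; field.
Qed.

Lemma energy_hess y z u v : U y ->
  2%:R * g y (NN y z u v) (beta y v) + 2%:R * g y (N y u v) (N y z v) =
  2^-1 * hess D a f y z u * h a y v v.
Proof.
move=> Uy; have [gr gl] := g_xi_bilin (C := C) (rep_img Uy).
have xb v' x : U x -> l x (beta x v') = 0 by move=> Ux; exact: lambda_d_pi.
have xN u' v' x : U x -> l x (N x u' v') = 0 by move=> Ux; exact: lambda_nabla_beta.
have sym s t : l y s = 0 -> l y t = 0 -> g y s t = g y t s := g_xi_sym (rep_img Uy).
have E1 : 'D_z (fun x => g x (N x u v) (beta x v)) y =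
    g y (nb z (fun x => N x u v) y) (beta y v) + g y (N y u v) (nb z (beta^~ v) y).
  exact: (g_xi_parallel Hnab Hw z Uy (diff_nabla_beta Hw u v Uy) (diff_d_pi Hw v Uy) (xN u v) (xb v)).
have e0 t x : U x -> g x (N x t v) (beta x v) = 4^-1 * 'D_t f x * h a x v v.
  move=> Ux; have := energy_derive t v v Ux.
  rewrite (g_xi_sym (rep_img Ux) (xb v x Ux) (xN t v x Ux)).
  set p := g x _ _; set q := 'D_t f x; set r := h _ _ _ _; clearbody p q r => H; lra.
have df := Ck_diff (Ck_derive u (Ck_energy 1)) Uy.
have E2 : 'D_z (fun x => g x (N x u v) (beta x v)) y =
    4^-1 * ('D_u f y * (h a y (D a y z v) v + h a y v (D a y z v))
      + 'D_z ('D_u f) y * h a y v v).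
  transitivity ('D_z (fun x => 4^-1 *: ('D_u f x *: (h a x v v : R^o))) y).
    apply: (eq_on_derive z oU Uy) => x Ux.
    by rewrite e0// -mulrA.
  have [d1 e1] := differentiable_scale (W := R^o) df (diff_h_rep v v Uy).
  rewrite deriveZ; last exact: diff_derivable.
  by rewrite e1 derive_h_rep.
have E3 : g y (nb z (fun x => N x u v) y) (beta y v) =
    g y (NN y z u v) (beta y v) + g y (N y u (D a y z v)) (beta y v)
    + g y (N y (D a y z u) v) (beta y v).
  have key (p q r t : E) : g y p t = g y (p - q - r) t + g y q t + g y r t.
    by rewrite -!(is_linD (gl _)) addrAC subrK subrK.
  exact: key.
have E4 : g y (N y u v) (nb z (beta^~ v) y) =
    g y (N y u v) (N y z v) + g y (N y u v) (beta y (D a y z v)).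
  have e1 : nb z (beta^~ v) y = N y z v + beta y (D a y z v) by exact: nabla_d_piE.
  have lin (p q t : E) : g y t (p + q) = g y t p + g y t q := is_linD (gr t) p q.
  transitivity (g y (N y u v) (N y z v + beta y (D a y z v))).
    exact: (congr1 (g y (N y u v)) e1).
  exact: lin.
have S5 : g y (beta y (D a y z v)) (N y u v) = g y (N y u v) (beta y (D a y z v)).
  exact: sym (xb _ _ Uy) (xN _ _ _ Uy).
exact: (energy_hess_algebra (etrans (esym E2) (etrans E1 (congr2 (fun p q => p + q) E3 E4)))
  (energy_derive u (D a y z v) v Uy) (e0 (D a y z u) y Uy) S5
  (h_sym (h := h) (rep_dom_img Uy) v (D a y z v))).
Qed.

End SecondOrder.

Section Commutation.
Context {R : realType} {n : nat} {M : manifold R n.*2.+1}.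
Context {C : contact_triad M} {nab : connection M} (Hnab : triad_connection C nab).
Context {S : riemann_surface R} {h : kahler_metric S}.
Context {D : connection S} (HD : levi_civita h D).
Context {w : S -> M} (Hw : contact_CR_map C w).
Context {a : chart S} {b : chart M}.
Local Notation P := 'rV[R]_2.
Local Notation E := 'rV[R]_(n.*2.+1).
Local Notation d_ i := (delta_mx 0 i : P).
Local Notation U := (rep_dom w a b).
Local Notation c := (rep w a b).
Local Notation j := (rs_j S a).
Local Notation l y := (lambda C b (c y)).
Local Notation J y := (ctJ C b (c y)).
Local Notation g y := (g_xi C b (c y)).
Local Notation nb u := (nabla_pi C nab w a b (cst u)).
Local Notation beta := (d_pi C w a b).
Local Notation tor := (torsion_pi C nab w a b).
Local Notation N := (nabla_beta C nab D w a b).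
Local Notation NN := (nabla2_beta C nab D w a b).
Local Notation sg := (torsion_density C nab h w a b).
Local Notation f := (energy_pi C h w a b).

Let oU : open U := rep_dom_open Hw.


Lemma nabla_pi_d_pi_field y z (V : P -> P) : U y -> differentiable V y ->
  nb z (fun x => beta x (V x)) y =
  N y z (V y) + (beta y (D a y z (V y)) + beta y ('D_z V y)).
Proof.
move=> Uy dV.
have e1 : nb z (beta^~ (V y)) y = N y z (V y) + beta y (D a y z (V y)) by exact: nabla_d_piE.
have e2 : nb z (fun x => beta x (V x)) y = nb z (beta^~ (V y)) y + beta y ('D_z V y).
  exact: (nabla_pi_field Hw z (F := beta) (V := V) Uy (fun x Ux => d_pi_lin Hw Ux)
    (fun v => diff_d_pi Hw v Uy) (fun v => lambda_d_pi v Uy) dV).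
exact: etrans e2 (etrans (congr1 (fun t => t + beta y ('D_z V y)) e1) (esym (addrA _ _ _))).
Qed.

Lemma nabla2_betaE y z u v : U y -> NN y z u v =
  nb z (nb u (beta^~ v)) y
  - (N y z (D a y u v) + (beta y (D a y z (D a y u v)) + beta y ('D_z (fun x => D a x u v) y)))
  - N y u (D a y z v) - N y (D a y z u) v.
Proof.
move=> Uy; have Ay := rep_dom_img Uy.
have dD : differentiable (fun x => D a x u v) y := Ck_diff (Ck_D a 0 u v) Ay.
have dbD : differentiable (fun x => beta x (D a x u v)) y.
  exact: (@differentiable_lin R P E 2 beta (fun x => D a x u v) y
    (near_open oU Uy (fun x Ux => d_pi_lin Hw Ux)) (fun t => diff_d_pi Hw t Uy) dD).1.
have dnb : differentiable (nb u (beta^~ v)) y := Ck_diff (Ck_nabla_d_pi Hw 0 u v) Uy.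
have E1 := nabla_piB (C := C) (nab := nab) z Uy dnb dbD.
have E2 := nabla_pi_d_pi_field z Uy dD.
exact: (congr1 (fun t => t - N y u (D a y z v) - N y (D a y z u) v)
  (etrans E1 (congr1 (fun t => nb z (nb u (beta^~ v)) y - t) E2))).
Qed.

Lemma nabla_pi0 s y : U y -> differentiable s y -> nb 0 s y = 0.
Proof. by move=> Uy ds; exact: (is_lin0 (nabla_pi_linl Hw Uy ds)). Qed.

Lemma curvature_piE u v s y : U y -> differentiable s y ->
  curvature_pi C nab w a b (cst u) (cst v) s y = nb u (nb v s) y - nb v (nb u s) y.
Proof.
move=> Uy ds; rewrite /curvature_pi lie_bracket_cst.
exact: etrans (congr1 (fun t => _ - t) (nabla_pi0 Uy ds)) (subr0 _).
Qed.

Lemma nabla2_beta_commute y z u v : U y -> NN y z u v - NN y u z v =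
  curvature_pi C nab w a b (cst z) (cst u) (beta^~ v) y - beta y (riem D a y z u v).
Proof.
move=> Uy; have lb := d_pi_lin Hw Uy.
(* Equations between derivatives are passed to an abstract identity: rewriting
   with them makes unification unfold matrix operations. *)
have key (X Y Z W A B n1 n2 n3 n4 b1 b2 b3 b4 : E) :
  X = A - (n1 + (b1 + b2)) - n2 - n3 -> Y = B - (n2 + (b3 + b4)) - n1 - n4 -> n3 = n4 ->
  Z = A - B -> W = b2 + b1 - (b4 + b3) -> X - Y = Z - W.
  by move=> -> -> -> -> ->; row_ring.
have e1 : beta y (riem D a y z u v) =
    beta y ('D_z (fun x => D a x u v) y) + beta y (D a y z (D a y u v)) -
    (beta y ('D_u (fun x => D a x z v) y) + beta y (D a y u (D a y z v))).
  exact: etrans (is_linB lb _ _) (congr2 (fun p q => p - q) (is_linD lb _ _) (is_linD lb _ _)).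
have e2 := curvature_piE z u Uy (diff_d_pi Hw v Uy).
have e3 : N y (D a y z u) v = N y (D a y u z) v.
  by rewrite (D_sym HD (rep_dom_img Uy) z u).
exact: (key _ _ _ _ _ _ _ _ _ _ _ _ _ _ (nabla2_betaE z u v Uy) (nabla2_betaE u z v Uy) e3 e2 e1).
Qed.

Lemma nabla2_beta_j y z u v : U y -> NN y z u (j y v) = J y (NN y z u v).
Proof.
move=> Uy; have lJ := ctJ_lin (C := C) (rep_img Uy).
have [n1 n2] := nabla_beta_bilin (D := D) (nab := nab) Hw Uy.
have E1 : nb z (fun x => N x u (j x v)) y =
    nb z (fun x => N x u (j y v)) y + N y u ('D_z (fun x => j x v) y).
  apply: (nabla_pi_field Hw z (F := fun x t => N x u t) (V := fun x => j x v) Uy).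
  - by move=> x Ux; exact: (nabla_beta_bilin Hw Ux).1.
  - by move=> t; exact: (diff_nabla_beta Hw).
  - by move=> t; exact: lambda_nabla_beta.
  - exact: (diff_j v Uy).
have E2 : nb z (fun x => N x u (j x v)) y = J y (nb z (fun x => N x u v) y).
  transitivity (nb z (fun x => J x (N x u v)) y).
    by apply: (eq_nabla_pi Hw z Uy) => x Ux; exact: (nabla_beta_j Hnab HD Hw).
  apply: (ctJ_parallel Hnab Hw z Uy); first exact: (diff_nabla_beta Hw).
  by move=> x Ux; exact: lambda_nabla_beta.
have E3 : N y u ('D_z (fun x => j x v) y) = J y (N y u (D a y z v)) - N y u (D a y z (j y v)).
  have e1 := congr1 (N y u) (derive_j HD z v Uy).
  have e2 := is_linB (n1 u) (j y (D a y z v)) (D a y z (j y v)).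
  have e3 := nabla_beta_j Hnab HD Hw u (D a y z v) Uy.
  exact: etrans e1 (etrans e2 (congr1 (fun t => t - _) e3)).
have E4 := nabla_beta_j Hnab HD Hw (D a y z u) v Uy.
have key (X Y p q r s t t' o m : E) : X = p - s - t -> Y = q - r - t' -> m = p + o -> m = q ->
    o = r - s -> t = t' -> X = Y.
  by move=> -> -> -> <- -> ->; row_ring.
have E5 : J y (NN y z u v) =
    J y (nb z (fun x => N x u v) y) - J y (N y u (D a y z v)) - J y (N y (D a y z u) v).
  exact: etrans (is_linB lJ _ _) (congr1 (fun t => t - _) (is_linB lJ _ _)).
exact: (key _ _ _ _ _ _ _ _ _ _ erefl E5 E1 E2 E3 E4).
Qed.

Lemma nabla2_beta_swap y z u v : U y ->
  NN y z u v - NN y z v u = h a y (j y u) v *: nb z sg y.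
Proof.
move=> Uy; have Ay := rep_dom_img Uy.
have sw x p q : U x -> N x p q - N x q p = h a x (j x p) q *: sg x.
  move=> Ux; have e1 : N x p q - N x q p = tor x p q := nabla_beta_swap HD p q Ux.
  have e2 : tor x p q = h a x (j x p) q *: sg x := torsion_density_area Hw p q Ux.
  exact: etrans e1 e2.
have dk : differentiable (fun x => h a x (j x u) v) y := Ck_diff (Ck_area 0 u v) Uy.
have ds : differentiable sg y := Ck_diff (Ck_torsion_density Hw 0) Uy.
have E1 := nabla_piB (C := C) (nab := nab) z Uy 
  (diff_nabla_beta (nab := nab) (D := D) Hw u v Uy)
  (diff_nabla_beta (nab := nab) (D := D) Hw v u Uy).
have E2 : nb z (fun x => N x u v - N x v u) y = nb z (fun x => h a x (j x u) v *: sg x) y.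
  by apply: (eq_nabla_pi Hw z Uy) => x Ux; exact: sw.
have E3 := nabla_pi_scale (C := C) (nab := nab) z Uy dk ds.
have E4 : xi_proj C b (c y) (sg y) = sg y := xi_proj_xi (lambda_torsion_density Uy).
have E5 := area_parallel HD z u v Ay.
have key (A B X X' n1 n2 m1 m2 Sz s s' : E) (k k' k1 k2 : R) : X = A - B -> X = X' ->
   X' = k *: Sz + k' *: s' -> s' = s -> k' = k1 + k2 ->
   n1 - m2 = k2 *: s -> n2 - m1 = k1 *: s -> A - n1 - n2 - (B - m1 - m2) = k *: Sz.
  move=> H1 H2 H3 H4 H5 H6 H7.
  have -> : A - n1 - n2 - (B - m1 - m2) = (A - B) - (n1 - m2) - (n2 - m1) by row_ring.
  by rewrite -H1 H2 H3 H4 H5 H6 H7; row_ring.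
exact: (key _ _ _ _ _ _ _ _ _ _ _ _ _ _ _ E1 E2 E3 E4 E5 (sw y u (D a y z v) Uy)
  (sw y (D a y z u) v Uy)).
Qed.

End Commutation.

Section Bochner.
Context {R : realType} {n : nat} {M : manifold R n.*2.+1}.
Context {C : contact_triad M} {nab : connection M} (Hnab : triad_connection C nab).
Context {S : riemann_surface R} {h : kahler_metric S}.
Context {D : connection S} (HD : levi_civita h D).
Context {w : S -> M} (Hw : contact_CR_map C w).
Context {a : chart S} {b : chart M}.
Local Notation P := 'rV[R]_2.
Local Notation E := 'rV[R]_(n.*2.+1).
Local Notation d_ i := (delta_mx 0 i : P).
Local Notation U := (rep_dom w a b).
Local Notation c := (rep w a b).
Local Notation j := (rs_j S a).
Local Notation l y := (lambda C b (c y)).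
Local Notation J y := (ctJ C b (c y)).
Local Notation g y := (g_xi C b (c y)).
Local Notation nb u := (nabla_pi C nab w a b (cst u)).
Local Notation beta := (d_pi C w a b).
Local Notation tor := (torsion_pi C nab w a b).
Local Notation N := (nabla_beta C nab D w a b).
Local Notation NN := (nabla2_beta C nab D w a b).
Local Notation sg := (torsion_density C nab h w a b).
Local Notation f := (energy_pi C h w a b).

Let oU : open U := rep_dom_open Hw.


Lemma nabla2_beta_linr y z u : U y -> is_lin (NN y z u).
Proof.
move=> Uy k p q; have Ay := rep_dom_img Uy.
have [n1 n2] := nabla_beta_bilin (nab := nab) (D := D) Hw Uy.
have l1 : nb z (fun x => N x u (k *: p + q)) y =
    k *: nb z (fun x => N x u p) y + nb z (fun x => N x u q) y.
  exact: (nabla_pi_linr Hw z (F := fun x v => N x u v) Uy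
    (fun x Ux => (nabla_beta_bilin Hw Ux).1 u) (fun v => diff_nabla_beta Hw u v Uy)).
have l2 : N y u (D a y z (k *: p + q)) = k *: N y u (D a y z p) + N y u (D a y z q).
  have d : D a y z (k *: p + q) = k *: D a y z p + D a y z q := D_linr Ay z k p q.
  exact: etrans (congr1 (N y u) d) (n1 u k (D a y z p) (D a y z q)).
have l3 := n1 (D a y z u) k p q.
have key (A A1 A2 B B1 B2 F F1 F2 : E) : A = k *: A1 + A2 -> B = k *: B1 + B2 ->
    F = k *: F1 + F2 -> A - B - F = k *: (A1 - B1 - F1) + (A2 - B2 - F2).
  by move=> -> -> ->; row_ring.
exact: (key _ _ _ _ _ _ _ _ _ l1 l2 l3).
Qed.

Lemma diff_torsion_density y : U y -> differentiable sg y.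
Proof. exact: (Ck_diff (Ck_torsion_density Hw 0)). Qed.

Lemma nabla2_beta_trace y k (e : 'I_2 -> P) : U y -> orthonormal_frame h a y e ->
  \sum_i NN y k (e i) (e i) = - J y (nb k sg y).
Proof.
move=> Uy he; have Ay := rep_dom_img Uy; have lJ := ctJ_lin (C := C) (rep_img Uy).
have [s ss [j0 j1]] := frame_j (h_bilin (h := h) Ay) (h_sym Ay) (jj Ay) (h_j Ay) he.
have e1E : e 1 = s *: j y (e 0) by rewrite j0 scalerA ss scale1r.
have linZ (z t : P) (q : R) : NN y k z (q *: t) = q *: NN y k z t.
  exact: (is_linZ (nabla2_beta_linr k z Uy)).
have a1 : NN y k (e 1) (e 1) = s *: NN y k (e 1) (j y (e 0)).
  exact: etrans (congr1 (NN y k (e 1)) e1E) (linZ (e 1) (j y (e 0)) s).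
have a2 := nabla2_beta_j Hnab HD Hw k (e 1) (e 0) Uy.
have a3 := nabla2_beta_swap (nab := nab) HD Hw k (e 1) (e 0) Uy.
have a4 : h a y (j y (e 1)) (e 0) = - s.
  by rewrite j1 (is_linZ ((h_bilin Ay).2 _)) he eqxx -[_ *: _]/(_ * _) mulr1.
have a5 := nabla2_beta_j Hnab HD Hw k (e 0) (e 1) Uy.
have a6 : NN y k (e 0) (j y (e 1)) = - s *: NN y k (e 0) (e 0).
  exact: etrans (congr1 (NN y k (e 0)) j1) (linZ (e 0) (e 0) (- s)).
rewrite sum_I2.
have key (A00 A11 A10 A01 B0 B1 T : E) r : A11 = s *: B0 -> B0 = J y A10 ->
    A10 - A01 = r *: T -> r = - s -> B1 = J y A01 -> B1 = - s *: A00 ->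
    A00 + A11 = - J y T.
  move=> -> -> H1 Hr H2 H3.
  have -> : A10 = r *: T + A01 by rewrite -H1 subrK.
  rewrite Hr (is_linD lJ) (is_linZ lJ) -H2 H3.
  move: (J y T) => JT.
  have -> : A00 + s *: (- s *: JT + - s *: A00) = A00 - (s * s) *: JT - (s * s) *: A00.
    by row_ring.
  by rewrite ss; row_ring.
exact: (key _ _ _ _ _ _ _ _ a1 a2 a3 a4 a5 a6).
Qed.

Lemma rough_laplacian y v (e : 'I_2 -> P) : U y -> orthonormal_frame h a y e ->
  \sum_i NN y (e i) (e i) v =
  ricci_pi C nab w a b e beta y v - \sum_i beta y (riem D a y (e i) v (e i))
  - J y (nb v sg y) - nb (j y v) sg y.
Proof.
move=> Uy he; have Ay := rep_dom_img Uy.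
have t := nabla2_beta_trace v Uy he; rewrite sum_I2 in t.
have c0 := nabla2_beta_commute (nab := nab) HD Hw (e 0) v (e 0) Uy.
have c1 := nabla2_beta_commute (nab := nab) HD Hw (e 1) v (e 1) Uy.
have s0 := nabla2_beta_swap (nab := nab) HD Hw (e 0) (e 0) v Uy.
have s1 := nabla2_beta_swap (nab := nab) HD Hw (e 1) (e 1) v Uy.
have hE i : h a y (j y (e i)) v = - h a y (j y v) (e i).
  by rewrite (h_jl (h_bilin (h := h) Ay) (jj Ay) (h_j Ay)) (h_sym Ay).
have L : nb (j y v) sg y =
    h a y (j y v) (e 0) *: nb (e 0) sg y + h a y (j y v) (e 1) *: nb (e 1) sg y.
  exact: (is_lin_frame (h_bilin (h := h) Ay) he
    (nabla_pi_linl Hw Uy (diff_torsion_density Uy)) (j y v)).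
rewrite sum_I2 /ricci_pi !sum_I2.
have key (A00 A11 Av0 Av1 B0 B1 R0 R1 b0 b1 T0 T1 Jt T : E) (k0 k1 k0' k1' : R) :
    B0 + B1 = - Jt -> Av0 - B0 = R0 - b0 -> Av1 - B1 = R1 - b1 ->
    A00 - Av0 = k0 *: T0 -> A11 - Av1 = k1 *: T1 -> k0 = - k0' -> k1 = - k1' ->
    T = k0' *: T0 + k1' *: T1 -> A00 + A11 = R0 + R1 - (b0 + b1) - Jt - T.
  move=> H1 H2 H3 H4 H5 H6 H7 ->.
  have -> : A00 + A11 = (A00 - Av0) + (A11 - Av1) + ((Av0 - B0) + (Av1 - B1)) + (B0 + B1).
    by row_ring.
  by rewrite H1 H2 H3 H4 H5 H6 H7; row_ring.
exact: (key _ _ _ _ _ _ _ _ _ _ _ _ _ _ _ _ _ _ t c0 c1 s0 s1 (hE 0) (hE 1) L).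
Qed.

Lemma rough_laplacian_inner y (e : 'I_2 -> P) : U y -> orthonormal_frame h a y e ->
  \sum_i \sum_k g y (NN y (e i) (e i) (e k)) (beta y (e k)) =
  gauss_curvature h D a y * f y
  + \sum_k g y (ricci_pi C nab w a b e beta y (e k)) (beta y (e k))
  + \sum_k g y (- (2%:R *: nb (j y (e k)) sg y)) (beta y (e k)).
Proof.
move=> Uy he; have Ay := rep_dom_img Uy; have [gr gl] := g_xi_bilin (C := C) (rep_img Uy).
have lJ := ctJ_lin (C := C) (rep_img Uy).
have xn v : l y (nb v sg y) = 0 := lambda_nabla_pi v sg Uy.
have gJ t v : l y t = 0 -> g y (J y t) (beta y v) = - g y t (beta y (j y v)).
  move=> lt; rewrite -(ctJ_d_pi Hw v Uy).
  rewrite -(g_xi_ctJ (rep_img Uy) (lambda_ctJ (rep_img Uy) t) (lambda_d_pi v Uy)).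
  by rewrite (ctJ_sqr (rep_img Uy) lt) (is_linN (gl _)).
have step k : \sum_i g y (NN y (e i) (e i) (e k)) (beta y (e k)) =
    g y (ricci_pi C nab w a b e beta y (e k)) (beta y (e k))
    - 2^-1 * f y * (\sum_i h a y (riem D a y (e i) (e k) (e i)) (e k))
    + g y (nb (e k) sg y) (beta y (j y (e k))) - g y (nb (j y (e k)) sg y) (beta y (e k)).
  have r1 := congr1 (fun t => g y t (beta y (e k))) (rough_laplacian (e k) Uy he).
  have r2 := is_lin_sum (gl (beta y (e k))) (index_enum _) xpredT (fun i => NN y (e i) (e i) (e k)).
  have r3 : g y (\sum_i beta y (riem D a y (e i) (e k) (e i))) (beta y (e k)) =
      2^-1 * f y * (\sum_i h a y (riem D a y (e i) (e k) (e i)) (e k)).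
    rewrite mulr_sumr; apply: etrans (is_lin_sum (gl (beta y (e k))) _ _ _) _.
    by apply: eq_bigr => i _; exact: (g_d_pi Hw _ _ Uy).
  have lB (p q : E) : g y (p - q) (beta y (e k)) = g y p (beta y (e k)) - g y q (beta y (e k)).
    exact: (is_linB (gl _)).
  have r4 (p q r s : E) : g y (p - q - r - s) (beta y (e k)) =
      g y p (beta y (e k)) - g y q (beta y (e k)) - g y r (beta y (e k)) - g y s (beta y (e k)).
    by rewrite !lB.
  have r5 := gJ (nb (e k) sg y) (e k) (xn (e k)).
  have key (A X Y p q r s q' r' : R) : X = A -> X = Y -> Y = p - q - r - s -> q = q' -> r = - r' ->
      A = p - q' + r' - s.
    by move=> <- -> -> -> ->; rewrite opprK.
  exact: (key _ _ _ _ _ _ _ _ _ r2 r1 (r4 _ _ _ _) r3 r5).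
rewrite exchange_big /= (eq_bigr _ (fun k _ => step k)).
have T : \sum_k g y (nb (e k) sg y) (beta y (j y (e k))) =
    - \sum_k g y (nb (j y (e k)) sg y) (beta y (e k)).
  apply: (trace_j (h_bilin (h := h) Ay) (h_sym Ay) (jj Ay) (h_j Ay) he (W := R^o)
    (B := fun u v => g y (nb u sg y) (beta y v))).
  split=> [u|v] k p q; first by rewrite (d_pi_lin Hw Uy); exact: gr.
  have n1 : nb (k *: p + q) sg y = k *: nb p sg y + nb q sg y.
    exact: (nabla_pi_linl Hw Uy (diff_torsion_density Uy) k p q).
  exact: etrans (congr1 (fun t => g y t (beta y v)) n1)
    (gl (beta y v) k (nb p sg y) (nb q sg y)).
have K : \sum_k \sum_i h a y (riem D a y (e i) (e k) (e i)) (e k) =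
    - 2 * gauss_curvature h D a y.
  by rewrite exchange_big; exact: (riem_trace HD Ay he).
have g2 k : g y (- (2%:R *: nb (j y (e k)) sg y)) (beta y (e k)) =
    - (2 * g y (nb (j y (e k)) sg y) (beta y (e k))).
  move: (nb (j y (e k)) sg y) (beta y (e k)) => t t'.
  by rewrite (is_linN (gl t')) (is_linZ (gl t')).
rewrite (eq_bigr _ (fun k _ => g2 k)).
have key (r H p q : 'I_2 -> R) (K0 f0 : R) : \sum_k p k = - \sum_k q k ->
    \sum_k H k = - 2 * K0 ->
    \sum_k (r k - 2^-1 * f0 * H k + p k - q k) =
    K0 * f0 + \sum_k r k + \sum_k (- (2 * q k)).
  rewrite !sum_I2 => Ep EH.
  have -> : r 0 - 2^-1 * f0 * H 0 + p 0 - q 0 + (r 1 - 2^-1 * f0 * H 1 + p 1 - q 1) =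
    r 0 + r 1 + (p 0 + p 1) - q 0 - q 1 - 2^-1 * f0 * (H 0 + H 1) by ring.
  by rewrite Ep EH; field.
exact: (key (fun k => g y (ricci_pi C nab w a b e beta y (e k)) (beta y (e k))) _ _
  (fun k => g y (nb (j y (e k)) sg y) (beta y (e k))) _ (f y) T K).
Qed.

Lemma laplacian_energy y (e : 'I_2 -> P) : U y -> orthonormal_frame h a y e ->
  - 2^-1 * laplacian h a f y =
  \sum_i \sum_k g y (N y (e i) (e k)) (N y (e i) (e k))
  + \sum_i \sum_k g y (NN y (e i) (e i) (e k)) (beta y (e k)).
Proof.
move=> Uy he.
have -> : laplacian h a f y = - \sum_i hess D a f y (e i) (e i).
  exact: (laplacian_hess HD oU (@rep_dom_img _ _ _ _ w a b) (Ck_energy Hw 1) Uy he).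
have H i k : hess D a f y (e i) (e i) =
    4%:R * g y (NN y (e i) (e i) (e k)) (beta y (e k))
    + 4%:R * g y (N y (e i) (e k)) (N y (e i) (e k)).
  have := energy_hess Hnab HD Hw (e i) (e i) (e k) Uy; rewrite he eqxx mulr1.
  set p := g y _ _; set q := g y _ _; set r := hess _ _ _ _ _ _; clearbody p q r => E1.
  have -> : 4%:R * p + 4%:R * q = 2%:R * (2%:R * p + 2%:R * q) by ring.
  by rewrite E1; field.
have key (x : 'I_2 -> R) (p q : 'I_2 -> 'I_2 -> R) :
  (forall i k, x i = 4%:R * p i k + 4%:R * q i k) ->
  - 2^-1 * - (\sum_i x i) = \sum_i \sum_k q i k + \sum_i \sum_k p i k.
  move=> Ex; rewrite !sum_I2.
  have -> : - 2^-1 * - (x 0 + x 1) = 4^-1 * (x 0 + x 0 + (x 1 + x 1)) by field.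
  by rewrite {1}(Ex 0 0) (Ex 0 1) {1}(Ex 1 0) (Ex 1 1); field.
exact: (key _ (fun i k => g y (NN y (e i) (e i) (e k)) (beta y (e k)))
  (fun i k => g y (N y (e i) (e k)) (N y (e i) (e k))) H).
Qed.

End Bochner.

Section Assembly.
Context {R : realType} {n : nat} {M : manifold R n.*2.+1}.
Context {C : contact_triad M} {nab : connection M} (Hnab : triad_connection C nab).
Context {S : riemann_surface R} {h : kahler_metric S}.
Context {D : connection S} (HD : levi_civita h D).
Context {w : S -> M} (Hw : contact_CR_map C w).
Context {a : chart S} {b : chart M}.
Local Notation P := 'rV[R]_2.
Local Notation E := 'rV[R]_(n.*2.+1).
Local Notation d_ i := (delta_mx 0 i : P).
Local Notation U := (rep_dom w a b).
Local Notation c := (rep w a b).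
Local Notation j := (rs_j S a).
Local Notation l y := (lambda C b (c y)).
Local Notation J y := (ctJ C b (c y)).
Local Notation g y := (g_xi C b (c y)).
Local Notation nb u := (nabla_pi C nab w a b (cst u)).
Local Notation beta := (d_pi C w a b).
Local Notation tor := (torsion_pi C nab w a b).
Local Notation N := (nabla_beta C nab D w a b).
Local Notation NN := (nabla2_beta C nab D w a b).
Local Notation sg := (torsion_density C nab h w a b).
Local Notation f := (energy_pi C h w a b).

Let oU : open U := rep_dom_open Hw.


Local Notation om := (wedge (pull_lambda_j C w a b) (LJ_del_pi C w a b)).

Lemma eq_curvature_pi u v s t y : U y -> (forall x, U x -> s x = t x) ->
  curvature_pi C nab w a b (cst u) (cst v) s y = curvature_pi C nab w a b (cst u) (cst v) t y.
Proof.
move=> Uy st; have e z x : U x -> nb z s x = nb z t x.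
  by move=> Ux; exact: eq_nabla_pi.
rewrite /curvature_pi lie_bracket_cst.
have e1 := eq_nabla_pi (nab := nab) Hw u Uy (e v).
have e2 := eq_nabla_pi (nab := nab) Hw v Uy (e u).
have key (A A' B B' F F' : E) : A = A' -> B = B' -> F = F' -> A - B - F = A' - B' - F'.
  by move=> -> -> ->.
exact: key e1 e2 (e 0 y Uy).
Qed.

Lemma ricci_pi_lin y (e : 'I_2 -> P) : U y -> is_lin (ricci_pi C nab w a b e beta y).
Proof.
move=> Uy.
have lc i : is_lin (fun v => curvature_pi C nab w a b (cst (e i)) (cst v) (beta^~ (e i)) y).
  move=> k p q; have ds x : U x -> differentiable (beta^~ (e i)) x by exact: (diff_d_pi Hw).
  have l1 := nabla_pi_linr (nab := nab) Hw (e i) (F := fun x v => nb v (beta^~ (e i)) x) Uy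
    (fun x Ux => nabla_pi_linl Hw Ux (ds x Ux))
    (fun v => Ck_diff (Ck_nabla_d_pi Hw 0 v (e i)) Uy) k p q.
  have l2 := nabla_pi_linl (nab := nab) Hw Uy (Ck_diff (Ck_nabla_d_pi (nab := nab) Hw 0 (e i) (e i)) Uy) k p q.
  have cE v := curvature_piE (nab := nab) Hw (e i) v Uy (ds y Uy).
  have key (X X1 X2 A A1 A2 B B1 B2 : E) : X = A - B -> X1 = A1 - B1 -> X2 = A2 - B2 ->
      A = k *: A1 + A2 -> B = k *: B1 + B2 -> X = k *: X1 + X2.
    by move=> -> -> -> -> ->; exact: scaleDB.
  exact: (key _ _ _ _ _ _ _ _ _ (cE (k *: p + q)) (cE p) (cE q) l1 l2).
move=> k p q; rewrite /ricci_pi scaler_sumr -big_split /=.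
by apply: eq_bigr => i _; exact: lc.
Qed.

Lemma delta_nabla2_wedge y v : U y ->
  delta_nabla2 C nab h w a b om y v = - (2%:R *: nb (j y v) sg y).
Proof.
move=> Uy; rewrite /delta_nabla2 /star1 /d_nabla0 opprK.
have e1 x : U x -> star2 h a om x = (- 2%:R : R) *: sg x.
  move=> Ux; rewrite /star2 (wedge_torsion_pi Hnab h Hw _ _ Ux).
  rewrite /torsion_density /area_form scalerN !scalerA mulrC.
  by rewrite mulNr scaleNr.
have ds : differentiable sg y := Ck_diff (Ck_torsion_density Hw 0) Uy.
have e2 := nabla_pi_scale (nab := nab) (C := C) (j y v) (k := cst (- 2%:R : R)) Uy
  (differentiable_cst _ _) ds.
have e3 := eq_nabla_pi (nab := nab) Hw (j y v) Uy e1.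
have key (X X' T T' : E) (r : R) : X = X' -> X' = (- 2%:R : R) *: T + r *: T' -> r = 0 ->
    X = - (2%:R *: T).
  by move=> -> -> ->; rewrite scale0r addr0 scaleNr.
exact: (key _ _ _ _ _ e3 e2 (derive_cst _ _ _)).
Qed.

Lemma nabla_form_del_pi y : U y -> nabla_form C nab D w a b (del_pi C w a b) y = N y.
Proof.
move=> Uy; apply/funext => u; apply/funext => v.
have e1 : nb u ((del_pi C w a b)^~ v) y = nb u (beta^~ v) y.
  by apply: (eq_nabla_pi Hw u Uy) => x Ux; exact: del_piE.
have e2 : nabla (D a) (cst u) (cst v) y = D a y u v by rewrite nabla_cst.
have key (A A' B B' : E) : A = A' -> B = B' -> A - B = A' - B' by move=> -> ->.
exact: key e1 (etrans (del_piE Hw _ Uy) (congr1 (beta y) e2)).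
Qed.

Lemma form2_norm2_nabla_beta y (e : 'I_2 -> P) : U y -> orthonormal_frame h a y e ->
  form2_norm2 C h w a b y (N y) =
  \sum_i \sum_k g y (N y (e i) (e k)) (N y (e i) (e k)).
Proof.
move=> Uy he; have [gr gl] := g_xi_bilin (C := C) (rep_img Uy).
have [n1 n2] := nabla_beta_bilin (nab := nab) (D := D) Hw Uy.
pose B u u' := \sum_k g y (N y u (e k)) (N y u' (e k)).
have BE u u' : form_inner C h w a b y (N y u) (N y u') = B u u'.
  exact: form_innerE.
have nE p q k i : N y (k *: p + q) (e i) = k *: N y p (e i) + N y q (e i) := n2 (e i) k p q.
have lB : is_bilin (W := R^o) B.
  split=> [u|u'] k p q; rewrite /B scaler_sumr -big_split; apply: eq_bigr => i _ /=.
    exact: etrans (congr1 (g y (N y u (e i))) (nE p q k i))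
      (gr (N y u (e i)) k (N y p (e i)) (N y q (e i))).
  exact: etrans (congr1 (fun t => g y t (N y u' (e i))) (nE p q k i))
    (gl (N y u' (e i)) k (N y p (e i)) (N y q (e i))).
transitivity (h_trace h a y B).
  by rewrite /form2_norm2; congr (h_trace h a y _); apply/funext => u; apply/funext => u'; exact: BE.
exact: (frame_trace (h_bilin (h := h) (rep_dom_img Uy)) he lB).
Qed.

End Assembly.

Theorem theorem1p4 (R : realType) (n : nat) (M : manifold R n.*2.+1)
    (C : contact_triad M) (nab : connection M) (Hnab : triad_connection C nab)
    (S : riemann_surface R) (h : kahler_metric S)
    (D : connection S) (HD : levi_civita h D)
    (w : S -> M) (Hw : contact_CR_map C w)
    (p : S) (a : chart S) (Ha : chart_dom a p) (b : chart M) (Hb : chart_dom b (w p))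
    (e : 'I_2 -> 'rV[R]_2) (He : orthonormal_frame h a (chart_map a p) e) :
  let x := chart_map a p in
  let del := del_pi C w a b in
  let inner := form_inner C h w a b x in
  - 2^-1 * laplacian h a (energy_pi C h w a b) x =
    form2_norm2 C h w a b x (nabla_form C nab D w a b del x)
    + gauss_curvature h D a x * form_norm2 C h w a b x (del x)
    + inner (ricci_pi C nab w a b e del x) (del x)
    + inner (delta_nabla2 C nab h w a b
               (wedge (pull_lambda_j C w a b) (LJ_del_pi C w a b)) x)
            (del x).
Proof.
move=> x del inner.
have Ux : rep_dom w a b x by split; [exact: chart_map_img|rewrite chart_mapK].
have delE : del x = d_pi C w a b x by apply/funext => v; exact: del_piE.
have ricE : ricci_pi C nab w a b e del x = ricci_pi C nab w a b e (d_pi C w a b) x.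
  apply/funext => v; apply: eq_bigr => i _; apply: (eq_curvature_pi Hw) => // y Uy.
  exact: del_piE.
have dE : delta_nabla2 C nab h w a b
    (wedge (pull_lambda_j C w a b) (LJ_del_pi C w a b)) x =
    fun v => - (2%:R *: nabla_pi C nab w a b (cst (rs_j S a x v))
      (torsion_density C nab h w a b) x).
  by apply/funext => v; exact: delta_nabla2_wedge.
have lb := d_pi_lin Hw Ux.
have ld : is_lin (fun v => - (2%:R *: nabla_pi C nab w a b (cst (rs_j S a x v))
    (torsion_density C nab h w a b) x)).
  move=> k u v.
  have ds : differentiable (torsion_density C nab h w a b) x := diff_torsion_density Hw Ux.
  have l1 := nabla_pi_linl (nab := nab) Hw Ux ds k (rs_j S a x u) (rs_j S a x v).
  rewrite (j_lin (rep_dom_img Ux)).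
  have key (A B F : 'rV[R]_n.*2.+1) : A = k *: B + F ->
      - (2%:R *: A) = k *: - (2%:R *: B) + - (2%:R *: F) by move=> ->; row_ring.
  exact: key l1.
rewrite (laplacian_energy Hnab HD Hw Ux He) (rough_laplacian_inner Hnab HD Hw Ux He).
rewrite /inner delE ricE dE (form_innerE Ux He (ricci_pi_lin Hw e Ux) lb).
rewrite (form_innerE Ux He ld lb) nabla_form_del_pi//.
rewrite (form2_norm2_nabla_beta Hw Ux He).
by rewrite !addrA.
Qed.
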